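(* Let $n,d\in\mathbb{N}$. (i) The noncommutative polynomial $H_{2d}(x_1,\dots,x_n)$ is a sum of $\binom{n-1+d}{d}$ hermitian squares in $\mathbb{R}\langle x_1,\dots,x_n\rangle$, and this number of hermitian squares is minimal: if $H_{2d}(x_1,\dots,x_n)=\sum_{j=1}^r q_j^*q_j$ with $q_j\in\mathbb{R}\langle x_1,\dots,x_n\rangle$, then $r\ge\binom{n-1+d}{d}$. (ii) Define $$\mu_{n,d}=\begin{cases}1 & \text{if } n=1,\\[4pt] \dfrac{\binom{n-1+2d}{2d}}{\binom{n-1+d}{d}\left(\binom{n-1+d}{d}+1\right)} & \text{if } n\ge 2 \text{ and } d \text{ is odd},\\[10pt] \dfrac{\binom{n-1+2d}{2d}}{\binom{n-1+d}{d}\left(\binom{n-1+d}{d}+n-1\right)} & \text{if } n\ge 2\text{ and } d\text{ is even}.\end{cases}$$ Then for all hermitian operators $X_1,\dots,X_n$ on a Hilbert space, $$H_{2d}(X_1,\dots,X_n)\succeq \mu_{n,d}\,(X_1^{2d}+\cdots+X_n^{2d}).$$ This lower bound is best possible: $\mu_{n,d}$ is the largest real number $\mu$ such that $H_{2d}(X_1,\dots,X_n)\succeq\mu(X_1^{2d}+\cdots+X_n^{2d})$ holds for all hermitian operators $X_1,\dots,X_n$ on any Hilbert space.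
   Context: $\mathbb{N}$ denotes the positive integers. $\mathbb{R}[x_1,\dots,x_n]$ is the commutative polynomial ring and $[x_1,\dots,x_n]$ its set of monomials. $\langle x_1,\dots,x_n\rangle$ is the set of all words in $n$ freely noncommuting variables, and $\mathbb{R}\langle x_1,\dots,x_n\rangle$ is the real free algebra, equipped with the $\mathbb{R}$-linear involution $*$ that reverses products and satisfies $x_j^*=x_j$. A hermitian square is an element $q^*q$ with $q\in\mathbb{R}\langle x_1,\dots,x_n\rangle$. The complete homogeneous symmetric polynomial is $h_d(x_1,\dots,x_n)=\sum_{1\le i_1\le\cdots\le i_d\le n}x_{i_1}\cdots x_{i_d}$, the sum of all monomials of degree $d$. Let $\alpha:\langle x_1,\dots,x_n\rangle\to[x_1,\dots,x_n]$ be abelianization (send a word to the corresponding commutative monomial), and let $\sigma:\mathbb{R}[x_1,\dots,x_n]\to\mathbb{R}\langle x_1,\dots,x_n\rangle$ be the linear map with $\sigma(m)=\frac{1}{|\alpha^{-1}(m)|}\sum_{w\in\alpha^{-1}(m)}w$ for each monomial $m$. The noncommutative complete homogeneous symmetric polynomial is $H_d(x_1,\dots,x_n)=\sigma(h_d(x_1,\dots,x_n))$. Hermitian operators are bounded self-adjoint operators, all of $X_1,\dots,X_n$ acting on the same Hilbert space, and $A\succeq B$ means that $A-B$ is positive semidefinite (Löwner order). *)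

(* Defs.v *)
From HB Require Import structures.
From mathcomp Require Import all_boot all_order all_algebra.
From mathcomp Require Import complex sesquilinear finmap.
From mathcomp.multinomials Require Import monalg.
From mathcomp Require Import all_classical all_reals all_analysis.

Set Implicit Arguments.
Unset Strict Implicit.
Unset Printing Implicit Defensive.

Import Order.TTheory GRing.Theory Num.Theory numFieldNormedType.Exports.

Local Open Scope ring_scope.

(* ['I_n] indexes the variables; [{fmonom 'I_n}] is the free monoid of words,
   [{cmonom 'I_n}] the free commutative monoid of monomials. *)
Notation word n := {fmonom 'I_n}.
Notation monomial n := {cmonom 'I_n}.
Notation cpoly R n := {malg R[monomial n]}.
Notation ncpoly R n := {malg R[word n]}.

Section Polynomials.
Context {R : realType} {n : nat}.

Definition ncstar (p : ncpoly R n) : ncpoly R n :=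
  \sum_(w <- msupp p) p@_w *: << FMonom (rev w) >>.

Definition hsym (d : nat) : cpoly R n :=
  \sum_(t : d.-tuple 'I_n | sorted <=%O t) \prod_(i <- t) << ucm i >>.

Definition abelianize (w : word n) : monomial n :=
  \big[mmul/mone]_(i <- w) ucm i.

(* The fibre of [abelianize] over [m]: all its words have length [mdeg m]
   (see [fibreP]), so it is a subset of a finite type. *)
Definition fibre (m : monomial n) : {set (mdeg m).-tuple 'I_n} :=
  [set t : (mdeg m).-tuple 'I_n | abelianize (FMonom t) == m].

Lemma fibreP (m : monomial n) (w : word n) :
  abelianize w = m <-> exists2 t, t \in fibre m & w = FMonom (tval t).
Proof.
split=> [<-|[t]]; last by rewrite inE => /eqP tm ->.
have szw : size w == mdeg (abelianize w).
  rewrite /abelianize mdeg_prod; under eq_bigr do rewrite mdegU.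
  by rewrite sum1_size.
exists (Tuple szw); first by rewrite inE /=; case: w {szw}.
by case: w szw.
Qed.

Definition symmetrize (p : cpoly R n) : ncpoly R n :=
  \sum_(m <- msupp p)
    p@_m *: (#|fibre m|%:R^-1 *: \sum_(t in fibre m) << FMonom (tval t) >>).

Definition Hsym (d : nat) : ncpoly R n := symmetrize (hsym d).

End Polynomials.

Arguments hsym R n d : clear implicits.
Arguments Hsym R n d : clear implicits.

(* Hilbert spaces over a scalar field [K] with conjugation [conj]; the inner
   product is linear in its first argument. *)
Record hilbertSpace (K : numFieldType) (conj : K -> K) := HilbertSpace {
  hilbert_sort :> completeNormedModType K ;
  inner : {dot hilbert_sort for conj} ;
  inner_norm : forall v : hilbert_sort, `|v| ^+ 2 = inner v v
}.

Section Operators.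
Context {K : numFieldType} {conj : K -> K} {V : hilbertSpace conj}.

Definition bounded_op (A : V -> V) : Prop :=
  exists M : K, forall v, `|A v| <= M * `|v|.

Definition self_adjoint (A : V -> V) : Prop :=
  forall u v, inner V (A u) v = inner V u (A v).

Definition psd (A : V -> V) : Prop :=
  self_adjoint A /\ forall v, 0 <= inner V (A v) v.

Definition loewner_ge (A B : V -> V) : Prop := psd (fun v => A v - B v).

(* The word [i_1 ... i_k] is sent to [X i_1 \o ... \o X i_k]. *)
Definition word_eval {n} (X : 'I_n -> V -> V) (w : word n) : V -> V :=
  foldr (fun i A => X i \o A) id w.

(* [iota] embeds the real coefficients into the scalars of [V]. *)
Definition nc_eval {R : realType} (iota : R -> K) {n}
    (X : 'I_n -> V -> V) (p : ncpoly R n) : V -> V :=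
  fun v => \sum_(w <- msupp p) iota p@_w *: word_eval X w v.

End Operators.

Definition power_sum_bound {R : realType} {K : numFieldType}
    (conj : K -> K) (iota : R -> K) (n d : nat) (mu : R) : Prop :=
  forall (V : hilbertSpace conj) (X : 'I_n -> {linear V -> V}),
    (forall i, bounded_op (X i) /\ self_adjoint (X i)) ->
    loewner_ge (nc_eval iota X (Hsym R n (2 * d)))
               (fun v => iota mu *: \sum_(i < n) iter (2 * d) (X i) v).

Definition real_bound (R : realType) : nat -> nat -> R -> Prop :=
  power_sum_bound (@idfun R) (@idfun R).

Definition complex_bound (R : realType) : nat -> nat -> R -> Prop :=
  power_sum_bound (@Num.conj (complex R)) (@real_complex R).

Definition mu_bound (R : realType) (n d : nat) : R :=
  let N := 'C(n - 1 + d, d) in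
  let M := 'C(n - 1 + 2 * d, 2 * d) in
  if n == 1%N then 1
  else if odd d then M%:R / (N%:R * (N%:R + 1))
  else M%:R / (N%:R * (N%:R + n%:R - 1)).

(* Main.v *)
Require Import Defs.
From HB Require Import structures.
From mathcomp Require Import all_boot all_order all_algebra.
From mathcomp Require Import complex sesquilinear finmap.
From mathcomp.multinomials Require Import monalg.
From mathcomp Require Import all_classical all_reals all_analysis.
From mathcomp Require Import ring lra zify.

Set Implicit Arguments.
Unset Strict Implicit.
Unset Printing Implicit Defensive.

Import Order.TTheory GRing.Theory Num.Theory numFieldNormedType.Exports.

Local Open Scope ring_scope.

(** A word of length [2 * d] is [rev u ++ v] for exactly one pair of words of
length [d], so [Hsym R n (2 * d)] has exactly one Gram matrix indexed by these
words. Writing [u_i] for the number of occurrences of the letter [i] in [u],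
its entry at [u, v] is [gram R d u v = (\prod_i (u_i + v_i)`!) / (2 * d)`!]
(lemmas [mcoeff_Hsym] and [HsymE]), the inverse of a multinomial coefficient.

The Gram matrix depends on [u] and [v] only through their letter counts, that
is, it is a matrix on the ['C(n - 1 + d, d)] multisets of size [d], repeated
along the words. Vandermonde's identity turns it into a sum of squares
[gram_feature] which is positive definite on multisets ([gram_posdef]). A
Cholesky factorization therefore yields ['C(n - 1 + d, d)] hermitian squares,
and the rank forbids fewer, since a decomposition of [Hsym] into hermitian
squares is a factorization of the Gram matrix once the polynomials have been
shown to have degree at most [d].

For the second part let [x_i^d] be the word [power_word d i]. On multisets, the
vectors [gram_dual R d i] are the columns of the inverse Gram matrix at the
pure powers: [gram] sends [gram_dual R d i] to the indicator of [x_i^d]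
([sum_gram_dual]). Read as polynomials, they are the reproducing kernel of the
forms of degree [d] on the simplex with one argument at a vertex, hence Jacobi
polynomials, which explains the closed form with a single binomial coefficient.
The identity behind [sum_gram_dual] is that a finite difference of order
[d + n - 1] annihilates polynomials of smaller degree ([finite_difference],
[urn_alternating_sum]). The compression of the inverse to the pure powers has
only two different entries, [dual_diag] and [dual_offdiag], of which the second
has the sign of [(-1) ^+ d]; its largest eigenvalue is the inverse of
[mu_bound R n d], attained for [1 < n] at the difference of two basis vectors
when [d] is odd and at the constant vector when [d] is even.

The operator inequality is then a Bessel inequality for the vectors
[word_eval X u v] with respect to the Gram matrix ([power_sum_bound_form]).
Conversely, when [mu] exceeds the bound, the form of [gram] minus [mu] times
the sum of the squares of the entries at the pure powers takes a negative value
at some [c] ([gram_gap]). A truncated Fock space carries self-adjoint operators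
for which a word [u] of length [d] sends the vacuum to [T * c u] times one fixed
unit vector plus a vector that is orthogonal to it and independent of [T]; for
large [T] this makes the quadratic form negative ([power_sum_bound_le]). *)

(** * Words with prescribed letter counts *)

Lemma big_tuple_cons (V : Type) (idx : V) (op : Monoid.com_law idx)
    (T : finType) d (F : d.+1.-tuple T -> V) :
  \big[op/idx]_t F t =
  \big[op/idx]_x \big[op/idx]_(t : d.-tuple T) F (cons_tuple x t).
Proof.
rewrite pair_big /= (reindex (fun p : T * d.-tuple T => cons_tuple p.1 p.2)) //=.
exists (fun t : d.+1.-tuple T => (thead t, behead_tuple t)) => [[x t] _ | t _] /=.
  by congr pair; apply: val_inj.
by case/tupleP: t => x t; apply: val_inj.
Qed.

Section Words.
Variable n : nat.
Implicit Types (i x : 'I_n) (c : 'I_n -> nat).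

Lemma prod_fact_incr c x :
  (\prod_i (c i + (x == i))`! = (c x).+1 * \prod_i (c i)`!)%N.
Proof.
rewrite (bigD1 x) //= [in RHS](bigD1 x) //= eqxx addn1 factS mulnA.
by congr (_ * _)%N; apply: eq_bigr => i /negPf; rewrite eq_sym => ->; rewrite addn0.
Qed.

Lemma sum_incr c x : (\sum_i (c i + (x == i)) = (\sum_i c i).+1)%N.
Proof.
rewrite big_split /= -addn1; congr (_ + _)%N.
rewrite (bigD1 x) //= eqxx big1 // => i /negPf; rewrite eq_sym => -> //.
Qed.

Lemma sum_count (w : seq 'I_n) : (\sum_i count_mem i w = size w)%N.
Proof.
elim: w => [|x w IH] /=; first by rewrite big1.
by under eq_bigr do rewrite addnC; rewrite sum_incr IH.
Qed.

(** The number of words with given letter counts is a multinomial coefficient: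
there are [c x] times as many words starting with [x], up to the common factor
[(\sum_i c i).-1`! / \prod_i (c i)`!], and [\sum_x c x = d]. *)
Lemma card_word_count d c : (\sum_i c i = d)%N ->
  (#|[set t : d.-tuple 'I_n | [forall i, count_mem i t == c i]]|
     * \prod_i (c i)`! = d`!)%N.
Proof.
rewrite -sum1dep_card [X in (X * _)%N]big_mkcond /=.
elim: d c => [|d IH] c sc.
  have c0 i : c i = 0%N.
    by move/eqP: sc; rewrite sum_nat_eq0 => /forallP/(_ i)/eqP.
  rewrite (big_pred1 [tuple]) => [|t]; last by apply/esym/eqP; rewrite [t]tuple0.
  rewrite ifT; last by apply/forallP => i; rewrite c0.
  by rewrite big1 // => i _; rewrite c0.
rewrite big_tuple_cons big_distrl /=.
rewrite factS -[in RHS]sc big_distrl /=; apply: eq_bigr => x _.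
have [cx0|cx_gt0] := posnP (c x).
  rewrite cx0 mul0n big1 ?mul0n // => t _; case: forallP => // /(_ x) /=.
  by rewrite eqxx cx0.
pose c' i := (c i - (x == i))%N.
have cE i : c i = (c' i + (x == i))%N.
  by rewrite /c' subnK //; case: (x =P i) => // <-.
have sc' : (\sum_i c' i = d)%N.
  by move: sc; under eq_bigr do rewrite cE; rewrite sum_incr => -[].
rewrite (eq_bigr (fun i => (c' i + (x == i))`!)%N) => [|i _]; last by rewrite -cE.
rewrite prod_fact_incr mulnCA -(IH c' sc') (cE x) eqxx addn1.
congr (_ * (_ * _))%N; apply: eq_bigr => t _; congr (if _ then _ else _).
by apply: eq_forallb => i; rewrite /= cE addnC eqn_add2r.
Qed.

(** The sum is that of a Polya urn. Drawing [x] multiplies the weight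
[\prod_i (a i)`!] by [(a x).+1], so the letters other than [i0] act together as
a single colour of total weight [\sum_(i | i != i0) (a i).+1], and only the
number [j] of draws of [i0] remains. When [i0] is the only letter the falling
factorial is [(m - j).-1 ^_ (m - j)], which vanishes except for [j = m], as it
should. *)
Lemma urn_sum (R : comRingType) i0 m (a : 'I_n -> nat) (f : nat -> R) :
  \sum_(v : m.-tuple 'I_n)
     f (count_mem i0 v) * (\prod_i (a i + count_mem i v)`!)%:R =
  \sum_(j < m.+1) 'C(m, j)%:R * f j *
    ((a i0 + j)`! * (((\sum_(i | i != i0) (a i).+1) + (m - j)).-1 ^_ (m - j))
     * \prod_(i | i != i0) (a i)`!)%:R.
Proof.
elim: m a f => [|m IH] a f.
  rewrite (big_pred1 [tuple]) => [|t]; last by apply/esym/eqP; rewrite [t]tuple0.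
  rewrite big_ord1 /= bin0 mul1r (bigD1 i0) //= ffactn0 muln1.
  by under eq_bigr do rewrite addn0.
set B := (\sum_(i | i != i0) (a i).+1)%N; set Q := (\prod_(i | i != i0) (a i)`!)%N.
rewrite big_tuple_cons /=.
transitivity (\sum_x \sum_(v : m.-tuple 'I_n) (f (count_mem i0 v + (x == i0)))
     * (\prod_i (a i + (x == i) + count_mem i v)`!)%:R).
  apply: eq_bigr => x _; apply: eq_bigr => v _; rewrite addnC; congr (_ * _%:R).
  by apply: eq_bigr => i _; rewrite addnA.
transitivity (\sum_x \sum_(j < m.+1) 'C(m, j)%:R * f (j + (x == i0))%N *
    ((a i0 + (x == i0) + j)`! *
     (((\sum_(i | i != i0) (a i + (x == i)).+1) + (m - j)).-1 ^_ (m - j))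
     * \prod_(i | i != i0) (a i + (x == i))`!)%:R).
  apply: eq_bigr => x _.
  by rewrite (IH (fun i => a i + (x == i))%N (fun k => f (k + (x == i0))%N)).
rewrite (bigD1 i0) //= eqxx.
have -> : (\sum_(i | i != i0) (a i + (i0 == i)).+1 = B)%N.
  by apply: eq_bigr => i /negPf; rewrite eq_sym => ->; rewrite addn0.
have -> : (\prod_(i | i != i0) (a i + (i0 == i))`! = Q)%N.
  by apply: eq_bigr => i /negPf; rewrite eq_sym => ->; rewrite addn0.
have -> : \sum_(x | x != i0) \sum_(j < m.+1) 'C(m, j)%:R * f (j + (x == i0))%N *
    ((a i0 + (x == i0) + j)`! *
     (((\sum_(i | i != i0) (a i + (x == i)).+1) + (m - j)).-1 ^_ (m - j))
     * \prod_(i | i != i0) (a i + (x == i))`!)%:R =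
   \sum_(j < m.+1) 'C(m, j)%:R * f j *
     ((a i0 + j)`! * ((B + (m.+1 - j)).-1 ^_ (m.+1 - j)) * Q)%:R.
  rewrite exchange_big /=; apply: eq_bigr => j _.
  transitivity (\sum_(x | x != i0) 'C(m, j)%:R * f j *
     ((a x).+1 * ((a i0 + j)`! * ((B + (m - j)) ^_ (m - j)) * Q))%:R).
    apply: eq_bigr => x xi0; rewrite (negPf xi0) !addn0; congr (_ * _%:R).
    rewrite mulnCA; congr (_ * _)%N; last first.
      rewrite (bigD1 x) //= /Q [in RHS](bigD1 x) //= eqxx addn1 factS mulnA.
      congr (_ * _)%N; apply: eq_bigr => i /andP[_ /negPf].
      by rewrite eq_sym => ->; rewrite addn0.
    congr (_ * (_ ^_ _))%N.
    suff -> : (\sum_(i | i != i0) (a i + (x == i)).+1 = B.+1)%N by [].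
    rewrite /B (bigD1 x) //= [in RHS](bigD1 x) //= eqxx addn1 addSn.
    congr (_ + _).+1%N; apply: eq_bigr => i /andP[_ /negPf].
    by rewrite eq_sym => ->; rewrite addn0.
  rewrite -mulr_sumr -natr_sum -big_distrl /= -/B; congr (_ * _%:R).
  rewrite subSn -1?ltnS // addnS /= ffactnSr addnK; ring.
rewrite [in RHS]big_ord_recl /= bin0 !subn0.
under [X in _ = _ + X]eq_bigr do rewrite /bump /= add1n binS subSS natrD 2!mulrDl.
rewrite big_split /= addrA [LHS]addrC; congr (_ + _).
  rewrite [in LHS]big_ord_recl [in RHS]big_ord_recr /= bin0 !subn0 bin_small // !mul0r addr0.
  congr (_ + _); apply: eq_bigr => j _; rewrite /bump /= add1n.
  by apply: eq_bigr => j _; rewrite addn1 -addnA add1n.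
Qed.
End Words.

(** * An alternating sum over words *)

(** Over a product of linear factors the induction needs no notion of degree:
the factor [j%:R] is absorbed into the binomial coefficient and lowers the
order of the difference, and the shift of the index moves every root by one. *)
Lemma finite_difference (R : comRingType) p (s : seq R) : (size s < p)%N ->
  \sum_(j < p.+1) (-1) ^+ j * 'C(p, j)%:R * \prod_(c <- s) (j%:R - c) = 0.
Proof.
move: {2}(size s) (erefl (size s)) => m; elim: m p s => [|m IH] p [|c s] //=.
  move=> _ p_gt0.
  under eq_bigr do rewrite big_nil mulr1.
  rewrite (_ : \sum__ _ = (1 - 1) ^+ p); first by rewrite subrr expr0n -(prednK p_gt0).
  by rewrite exprBn; apply: eq_bigr => i _; rewrite !expr1n !mulr1 mulr_natr.
case=> sm; case: p => // p; rewrite ltnS sm => mp.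
transitivity (\sum_(j < p.+2) (-1) ^+ j * 'C(p.+1, j)%:R * (j%:R * \prod_(c <- s) (j%:R - c))
  - c * \sum_(j < p.+2) (-1) ^+ j * 'C(p.+1, j)%:R * \prod_(c <- s) (j%:R - c)).
  rewrite mulr_sumr -sumrB; apply: eq_bigr => j _; rewrite big_cons; ring.
rewrite (IH p.+1 s sm) ?sm 1?ltnS 1?ltnW // mulr0 subr0.
rewrite big_ord_recl !mul0r mulr0 add0r.
have := IH p [seq c - 1 | c <- s]; rewrite size_map sm => /(_ erefl mp) IHs.
transitivity (- (p.+1%:R : R) * 0); last by rewrite mulr0.
rewrite -[in RHS]IHs mulr_sumr; apply: eq_bigr => j _.
have -> : \prod_(c <- s) ((lift ord0 j)%:R - c) = \prod_(c <- [seq c - 1 | c <- s]) (j%:R - c).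
  rewrite big_map; apply: eq_bigr => x _; rewrite /= /bump /= natrD; ring.
have := congr1 (fun k => k%:R : R) (mul_bin_diag p.+1 j).
rewrite /= !natrM /bump /= add1n exprS => e.
transitivity (- ((-1) ^+ j * (j.+1%:R * 'C(p.+1, j.+1)%:R) *
   \prod_(c <- [seq c - 1 | c <- s]) (j%:R - c))); last by rewrite -e; ring.
ring.
Qed.

(** The two falling factorials of the urn sum are written as products of linear
factors in [j], the form required by [finite_difference]. *)
Lemma natr_ffact_shift (R : comRingType) a j :
  ((a + j) ^_ a)%:R = \prod_(c <- [seq - (i.+1)%:R | i <- iota 0 a]) (j%:R - c) :> R.
Proof.
rewrite big_map -/(index_iota 0 a) -[in iota 0 a](subn0 a) big_nat_rev /=.
rewrite ffact_prod natr_prod big_mkord; apply: eq_bigr => i _.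
by have ia := ltn_ord i; rewrite add0n opprK -natrD; congr _%:R; lia.
Qed.

Lemma natr_ffact_reflect (R : comRingType) b d j : (j <= d)%N ->
  ((b + (d - j)) ^_ b)%:R
    = (-1) ^+ b * \prod_(c <- [seq (d + i.+1)%:R | i <- iota 0 b]) (j%:R - c) :> R.
Proof.
move=> jd; rewrite big_map -/(index_iota 0 b) -[in iota 0 b](subn0 b) big_nat_rev /=.
rewrite ffact_prod natr_prod big_mkord.
have -> : (-1) ^+ b = \prod_(i < b) (-1 : R) by rewrite prodr_const card_ord.
rewrite -big_split /=; apply: eq_bigr => i _.
have ib := ltn_ord i; rewrite add0n mulN1r opprB -natrB; last by lia.
by congr _%:R; lia.
Qed.

Section AlternatingSum.
Variables (R : numDomainType) (n d : nat) (i0 : 'I_n) (a : 'I_n -> nat).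
Hypothesis sum_a : (\sum_i a i = d)%N.
Let p := (d + n - 1)%N.

(** The weights [(-1) ^+ j * 'C(p, j)] turn the urn sum into a difference of
order [p] of a polynomial of degree [p - 1] which vanishes at [d + 1, ..., d + b],
where [d + b = p - 1 + (d - a i0)]. So the terms with [j <= d] sum to zero if
[a i0 < d], and to minus the term [j = p] if [a i0 = d]. *)
Lemma urn_alternating_sum :
  \sum_(v : d.-tuple 'I_n)
     (-1) ^+ count_mem i0 v * 'C(p, count_mem i0 v)%:R *
       (\prod_i (a i + count_mem i v)`!)%:R =
  (a i0 == d)%:R * (-1) ^+ d * (d`! * (p + d) ^_ d)%:R :> R.
Proof.
rewrite (urn_sum i0 d a (fun j => (-1) ^+ j * 'C(p, j)%:R)).
set B := (\sum_(i | i != i0) (a i).+1)%N; set Q := (\prod_(i | i != i0) (a i)`!)%N.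
have n_gt0 : (0 < n)%N by case: i0 => ? /(leq_ltn_trans (leq0n _)).
have aB : (a i0 + B = p)%N.
  have : (\sum_i (a i).+1 = d + n)%N.
    by under eq_bigr do rewrite -addn1; rewrite big_split /= sum_a sum1_card card_ord.
  by rewrite (bigD1 i0) //= -/B /p; lia.
have a_le : (a i0 <= d)%N by rewrite -sum_a (bigD1 i0) //= leq_addr.
(* [B = 0] means that [i0] is the only letter *)
case eB: B => [|b].
  have n1 : n = 1%N by move: eB aB; rewrite /p; lia.
  have ad : a i0 = d by move: aB; rewrite /p eB; lia.
  have pd : p = d by rewrite /p; lia.
  have Q1 : Q = 1%N.
    rewrite /Q big1 // => i ii0; suff: (i = i0) by move/eqP; rewrite (negPf ii0).
    by apply: val_inj => /=; have := ltn_ord i; have := ltn_ord i0; lia.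
  rewrite big_ord_recr /= big1 ?add0r; last first.
    move=> j _ /=; rewrite add0n ffact_small ?muln0 ?mul0n ?mulr0 //.
    by have := ltn_ord j; lia.
  rewrite pd !binn subnn ffactn0 ad eqxx Q1 !muln1 !mul1r mulr1; congr (_ * _%:R).
  by rewrite -(ffact_fact (leq_addl d d)) addnK mulnC.
pose s : seq R := [seq - (i.+1)%:R | i <- iota 0 (a i0)] ++
                  [seq (d + i.+1)%:R | i <- iota 0 b].
have sz : (size s < p)%N by rewrite size_cat !size_map !size_iota; lia.
have b_neq0 : (b`!)%:R != 0 :> R by rewrite pnatr_eq0 -lt0n fact_gt0.
apply: (mulfI b_neq0); rewrite mulr_sumr.
transitivity (\sum_(j < d.+1) (-1) ^+ b * (d`! * Q)%:R *
     ((-1) ^+ j * 'C(p, j)%:R * \prod_(c <- s) (j%:R - c))).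
  apply: eq_bigr => j _; have jd : (j <= d)%N by rewrite -ltnS.
  rewrite /s big_cat /= -natr_ffact_shift.
  set X := \prod_(c <- _) _.
  have e1 : (b`! * 'C(d, j) * ((a i0 + j)`! * (b + (d - j)) ^_ (d - j)) =
         d`! * ((a i0 + j) ^_ a i0 * (b + (d - j)) ^_ b))%N.
    have h1 := ffact_fact (leq_addl b (d - j)); rewrite addnK in h1.
    have h2 := ffact_fact (leq_addr j (a i0)); rewrite addKn in h2.
    have h3 := ffact_fact (leq_addr (d - j) b); rewrite addKn in h3.
    have h4 := bin_fact jd.
    transitivity ('C(d, j) * (a i0 + j)`! * (b + (d - j))`!)%N.
      by rewrite -h1; ring.
    by rewrite -h2 -h3 -h4; ring.
  have {}e1 := congr1 (fun k => k%:R : R) e1.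
  rewrite /= !natrM natr_ffact_reflect // -/X in e1.
  rewrite !natrM; set E := (_ ^_ (d - j))%:R in e1 *.
  transitivity ((-1) ^+ j * 'C(p, j)%:R * Q%:R *
     ((b`!)%:R * 'C(d, j)%:R * (((a i0 + j)`!)%:R * E))); first by ring.
  by rewrite e1; ring.
rewrite -mulr_sumr.
have := finite_difference sz.
set F := fun j : nat => (-1) ^+ j * 'C(p, j)%:R * \prod_(c <- s) (j%:R - c).
rewrite -(big_mkord xpredT F) -(big_mkord xpredT (F : nat -> R)).
have dp : (d <= p)%N by rewrite /p; lia.
rewrite (big_cat_nat (n := d.+1)) //= ?ltnS //.
have F0 j : (d < j <= d + b)%N -> F j = 0.
  move=> jdb; rewrite /F; apply/eqP; rewrite mulf_eq0 prodf_seq_eq0; apply/orP; right.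
  apply/hasP; exists j%:R; rewrite ?subrr ?eqxx // /s mem_cat; apply/orP; right.
  by apply/mapP; exists (j - d).-1; rewrite ?mem_iota; [lia | congr _%:R; lia].
have [ad|ad] := eqVneq (a i0) d; last first.
  rewrite [X in _ + X]big_nat_cond [X in _ + X]big1; last first.
    by move=> j /andP[jdb _]; apply: F0; lia.
  by rewrite addr0 => ->; rewrite /= mulr0n !mul0r !mulr0.
have pE : p = (d + b).+1 by rewrite -aB ad eB addnS.
rewrite [X in _ + X = 0 -> _]big_nat_recr /=; last by rewrite pE; lia.
rewrite [X in _ + (X + _)]big_nat_cond [X in _ + (X + _)]big1; last first.
  by move=> j /andP[jdb _]; apply: F0; lia.
rewrite add0r => /eqP; rewrite addr_eq0 => /eqP ->.
have Q1 : Q = 1%N.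
  rewrite /Q big1 // => i ii0; suff -> : a i = 0%N by [].
  by move: sum_a; rewrite (bigD1 i0) //= (bigD1 i) //=; lia.
rewrite Q1 muln1 mul1r /F binn mulr1 /s big_cat /= -natr_ffact_shift ad addnC.
have -> : \prod_(c <- [seq (d + i.+1)%:R | i <- iota 0 b]) (p%:R - c) = (b`!)%:R :> R.
  rewrite big_map -/(index_iota 0 b) -[in iota 0 b](subn0 b) big_mkord.
  rewrite -ffactnn ffact_prod natr_prod; apply: eq_bigr => i _.
  rewrite -natrB; last by have := ltn_ord i; lia.
  by congr _%:R; lia.
have sgn : (-1) ^+ b * (-1) ^+ p = - (-1) ^+ d :> R.
  rewrite pE exprS exprD; transitivity (- ((-1) ^+ d * ((-1) ^+ b) ^+ 2) : R); first by ring.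
  by rewrite sqrr_sign mulr1.
rewrite mulrN; set Y := _%:R; set Z := _%:R.
transitivity (- ((-1) ^+ b * (-1) ^+ p) * Y * (Z * (b`!)%:R)); first by ring.
by rewrite sgn natrM -/Y -/Z; ring.
Qed.
End AlternatingSum.

(** * The Gram matrix of words *)

(** Induction on the size: the Schur complement of the upper left entry of a
positive definite matrix is positive definite. *)
Lemma cholesky (R : rcfType) N (M : 'M[R]_N) :
  M^T = M -> (forall z : 'rV[R]_N, z != 0 -> 0 < (z *m M *m z^T) 0 0) ->
  exists Q : 'M[R]_N, M = Q^T *m Q.
Proof.
elim: N M => [|N IH] M symM posM; first by exists 0; apply/matrixP => -[].
rewrite -[N.+1]/(1 + N)%N in M symM posM *.
set m := ulsubmx M 0 0; set r := ursubmx M; set M' := drsubmx M.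
have ME : M = block_mx m%:M r r^T M'.
  rewrite -[LHS]submxK /r trmx_ursub symM; congr block_mx.
  by apply/matrixP => i j; rewrite !ord1 [RHS]mxE eqxx.
have m_gt0 : 0 < m.
  have := posM (row_mx 1 0); rewrite ME mul_row_block tr_row_mx mul_row_col.
  rewrite !mul1mx !mul0mx !addr0 trmx0 mulmx0 addr0 trmx1 mulmx1 mxE eqxx.
  apply; apply/eqP => /(congr1 (@lsubmx _ _ _ _)); rewrite row_mxKl => /matrixP/(_ 0 0).
  by apply/eqP; rewrite lsubmx_const !mxE oner_eq0.
have symM' : M'^T = M' by rewrite /M' trmx_drsub symM.
have [Q' Q'E] : exists Q' : 'M[R]_N, M' - m^-1 *: (r^T *m r) = Q'^T *m Q'.
  apply: IH => [|y y_neq0].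
    by rewrite linearB /= linearZ /= trmx_mul trmxK symM'.
  (* the vector over [y] on which the first row of [M] vanishes *)
  pose z := row_mx (- m^-1 *: (y *m r^T)) y.
  have : z != 0.
    apply: contra y_neq0 => /eqP z0; rewrite -[y](row_mxKr (- m^-1 *: (y *m r^T))).
    by rewrite -/z z0 linear0.
  move=> /posM; rewrite ME mul_row_block.
  have -> : - m^-1 *: (y *m r^T) *m m%:M + y *m r^T = 0.
    by rewrite mul_mx_scalar scalerA mulrN divff ?gt_eqF // scaleN1r addNr.
  rewrite tr_row_mx mul_row_col mul0mx add0r.
  congr (_ < (_ *m _) 0 0).
  by rewrite addrC scaleNr mulNmx -scalemxAl -mulmxA mulmxBr -scalemxAr.
exists (block_mx (Num.sqrt m)%:M ((Num.sqrt m)^-1 *: r) 0 Q').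
have sm : Num.sqrt m != 0 by rewrite gt_eqF ?sqrtr_gt0.
rewrite tr_block_mx mulmx_block trmx0 !mul0mx !mulmx0 !addr0 tr_scalar_mx -scalar_mxM.
rewrite -expr2 sqr_sqrtr ?ltW // mul_scalar_mx scalerA divff // scale1r.
rewrite !linearZ /= mul_mx_scalar -scalemxAl -?scalemxAr !scalerA ?divff // ?scale1r.
rewrite -invfM -expr2 sqr_sqrtr ?ltW //.
by rewrite -Q'E addrC subrK.
Qed.

Lemma binD_sum d a b : (b <= d)%N ->
  ('C(a + b, b) = \sum_(k < d.+1) 'C(a, k) * 'C(b, k))%N.
Proof.
move=> bd; rewrite -binomial.Vandermonde.
rewrite (big_ord_widen d.+1 (fun k => 'C(a, k) * 'C(b, b - k))%N) ?ltnS //.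
rewrite big_mkcond; apply: eq_bigr => k _; rewrite ltnS.
by case: leqP => [kb|kb]; [rewrite bin_sub | rewrite (bin_small kb) muln0].
Qed.

(** A kernel [(a + b)`!] is of positive type: it is a sum of products of a
function of [a] and the same function of [b]. The bound [d] on the index makes
the number of terms the same for all words of length [d]. *)
Lemma factD_sum d a b : (b <= d)%N ->
  ((a + b)`! = \sum_(k < d.+1) (a`! * 'C(a, k)) * (b`! * 'C(b, k)))%N.
Proof.
move=> bd; rewrite -(bin_fact (leq_addl a b)) addnK (binD_sum a bd) big_distrl /=.
by apply: eq_bigr => k _; ring.
Qed.

(** Multisets of size [d] are represented by sorted words. *)
Notation multiset_word n d := {t : d.-tuple 'I_n | sorted <=%O t}.

Section Gram.
Variables (R : rcfType) (n d : nat).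
Implicit Types (u v : d.-tuple 'I_n).

Definition gram (u v : seq 'I_n) : R :=
  (\prod_i (count_mem i u + count_mem i v)`!)%:R / ((2 * d)`!)%:R.

Definition feature (k : {ffun 'I_n -> 'I_d.+1}) (u : seq 'I_n) : R :=
  (\prod_i ((count_mem i u)`! * 'C(count_mem i u, k i)))%:R.

Lemma gramC u v : gram u v = gram v u.
Proof. by rewrite /gram; congr (_%:R / _); apply: eq_bigr => i _; rewrite addnC. Qed.

Lemma fact_neq0 k : (k`!)%:R != 0 :> R.
Proof. by rewrite pnatr_eq0 -lt0n fact_gt0. Qed.

Lemma gram_feature u v :
  gram u v = (((2 * d)`!)%:R)^-1 * \sum_k feature k u * feature k v.
Proof.
rewrite /gram mulrC; congr (_ * _).
transitivity ((\prod_i \sum_(k < d.+1) ((count_mem i u)`! * 'C(count_mem i u, k)) *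
   ((count_mem i v)`! * 'C(count_mem i v, k)))%N%:R : R).
  congr (_%:R); apply: eq_bigr => i _; rewrite -factD_sum //.
  by rewrite -[X in (_ <= X)%N](size_tuple v) count_size.
rewrite bigA_distr_bigA /= natr_sum; apply: eq_bigr => k _.
by rewrite big_split /= natrM.
Qed.

Lemma sort_word_subproof u :
  sorted <=%O [tuple of sort <=%O u].
Proof. exact: (sort_sorted le_total). Qed.

Definition sort_word u : multiset_word n d :=
  exist (fun t : d.-tuple 'I_n => is_true (sorted <=%O t)) _ (sort_word_subproof u).

Lemma count_sort_word u i : count_mem i (val (sort_word u)) = count_mem i u.
Proof. by apply/permP; rewrite /= perm_sort. Qed.

Lemma multiset_wordP (s t : multiset_word n d) :
  (forall i, count_mem i (val s) = count_mem i (val t)) -> s = t.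
Proof.
move=> st; apply: val_inj; apply: val_inj => /=.
apply: (sorted_eq le_trans le_anti (valP s) (valP t)).
by rewrite /perm_eq; apply/allP => i _ /=; rewrite st.
Qed.

Lemma gram_sort u v : gram (val (sort_word u)) (val (sort_word v)) = gram u v.
Proof.
rewrite /gram; congr (_%:R / _); apply: eq_bigr => i _.
by rewrite !count_sort_word.
Qed.

Lemma card_multiset_word : (0 < n)%N -> #|{: multiset_word n d}| = 'C(n - 1 + d, d).
Proof.
rewrite card_sig => n_gt0; case: n n_gt0 => // n' _; rewrite subSS subn0 addnC.
rewrite -card_sorted_tuples cardsE; apply: eq_card => t.
by rewrite inE [RHS]unfold_in sorted_map.
Qed.

(** If all feature sums vanish then so does [z s], because the feature whose
exponents are the letter counts of [s] is zero at every other multiset [t]: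
some letter occurs in [t] less often than in [s]. *)
Lemma gram_posdef (z : multiset_word n d -> R) :
  \sum_(s : multiset_word n d) \sum_(t : multiset_word n d)
     gram (val s) (val t) * z s * z t <= 0 ->
  forall s, z s = 0.
Proof.
move=> h.
pose f k := \sum_(s : multiset_word n d) feature k (val s) * z s.
have e : \sum_(s : multiset_word n d) \sum_(t : multiset_word n d)
     gram (val s) (val t) * z s * z t =
   (((2 * d)`!)%:R)^-1 * \sum_k f k ^+ 2.
  rewrite mulr_sumr.
  transitivity (\sum_(s : multiset_word n d) \sum_(t : multiset_word n d) \sum_k ((2 * d)`!%:R)^-1 *
     ((feature k (val s) * z s) * (feature k (val t) * z t))).
    apply: eq_bigr => s _; apply: eq_bigr => t _.
    rewrite gram_feature -mulrA -mulrA mulr_suml mulr_sumr.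
    by apply: eq_bigr => k _; ring.
  under eq_bigr do rewrite exchange_big /=.
  rewrite exchange_big /=; apply: eq_bigr => k _.
  rewrite expr2 /f big_distrlr /= mulr_sumr; apply: eq_bigr => s _.
  by rewrite mulr_sumr.
have f0 k : f k = 0.
  apply/eqP; rewrite -sqrf_eq0; apply/eqP.
  have /psumr_eq0P : (forall k, true -> 0 <= f k ^+ 2) by move=> k' _; exact: sqr_ge0.
  apply=> //; apply/eqP; rewrite eq_le sumr_ge0 ?andbT; last by move=> *; exact: sqr_ge0.
  by move: h; rewrite e pmulr_rle0 // invr_gt0 ltr0n fact_gt0.
move=> s; pose k := [ffun i => inord (count_mem i (val s)) : 'I_d.+1].
have ck i (t : multiset_word n d) : (count_mem i (val t) <= d)%N.
  by rewrite -[X in (_ <= X)%N](size_tuple (val t)) count_size.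
have kE i : k i = count_mem i (val s) :> nat by rewrite ffunE inordK // ltnS.
have := f0 k; rewrite /f (bigD1 s) //= big1 ?addr0 => [|t ts].
  move=> /eqP; rewrite mulf_eq0 => /orP[|/eqP//].
  rewrite pnatr_eq0 -leqn0 leqNgt => /negP[]; apply: prodn_gt0 => i.
  by rewrite muln_gt0 fact_gt0 bin_gt0 kE /=.
suff [i ilt] : exists i, (count_mem i (val t) < count_mem i (val s))%N.
  by rewrite /feature (bigD1 i) //= kE bin_small // muln0 mul0n mul0r.
apply/existsP; apply: contraR ts; rewrite negb_exists => /forallP st.
apply/eqP/multiset_wordP => i; apply/eqP.
have le j : (count_mem j (val s) <= count_mem j (val t))%N by rewrite leqNgt st.
have : (\sum_i count_mem i (val s) == \sum_i count_mem i (val t))%N.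
  by rewrite !sum_count !size_tuple.
rewrite eqn_leq => /andP[_].
move=> h'; rewrite eqn_leq le andbT.
rewrite (bigD1 i) //= [X in (_ <= X)%N](bigD1 i) //= in h'.
set r := (X in (_ + X)%N) in h'; set r' := (X in (_ <= _ + X)%N) in h'.
have rr : (r' <= r)%N by apply: leq_sum.
rewrite -(leq_add2r r); apply: leq_trans h' _.
by rewrite leq_add2l.
Qed.
End Gram.

(** * The dual vectors of the pure powers *)

Section GramDual.
Variables (R : realType) (n d : nat).
Hypotheses (n_gt0 : (0 < n)%N) (d_gt0 : (0 < d)%N).
Implicit Types (u v : d.-tuple 'I_n) (i j : 'I_n).

Let N : R := ('C(n - 1 + d, d))%:R.
Let C : R := ('C(n - 1 + 2 * d, 2 * d))%:R.

(** Up to normalization, the coefficients of the Jacobi polynomial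
[\sum_j (-1) ^+ (d - j) 'C(d + n - 1, j) 'C(d, j) x_i ^ j (s - x_i) ^ (d - j)],
with [s] the sum of the variables, spread evenly over the words. *)
Definition gram_dual i (v : seq 'I_n) : R :=
  ('C(n - 1 + d, d))%:R / ('C(n - 1 + 2 * d, 2 * d))%:R *
  ((-1) ^+ (d + count_mem i v) * 'C(d + n - 1, count_mem i v)%:R).

Definition power_word i : d.-tuple 'I_n := nseq_tuple d i.

Let N_gt0 : 0 < N. Proof. by rewrite ltr0n bin_gt0 leq_addl. Qed.
Let C_gt0 : 0 < C. Proof. by rewrite ltr0n bin_gt0 leq_addl. Qed.

Lemma power_wordE i u : (count_mem i u == d) = (u == power_word i).
Proof.
apply/eqP/eqP => [cu|->]; last by rewrite /= count_nseq /= eqxx mul1n.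
have /all_pred1P uE : all (pred1 i) u by rewrite all_count cu size_tuple.
by apply: val_inj; rewrite /= uE size_tuple.
Qed.

Lemma sum_gram_dual i u :
  \sum_(v : d.-tuple 'I_n) gram R d u v * gram_dual i v = (u == power_word i)%:R.
Proof.
transitivity (N / C * (-1) ^+ d / ((2 * d)`!)%:R *
   \sum_(v : d.-tuple 'I_n) (-1) ^+ count_mem i v * 'C(d + n - 1, count_mem i v)%:R * (\prod_j (count_mem j u + count_mem j v)`!)%:R).
  rewrite mulr_sumr; apply: eq_bigr => v _.
  rewrite /gram /gram_dual -/N -/C exprD; ring.
rewrite (urn_alternating_sum R i); last by rewrite sum_count size_tuple.
rewrite power_wordE; case: eqP => _; last by rewrite !mul0r mulr0.
set X := (d`! * _)%N.
have NX : (('C(n - 1 + d, d) * X) = 'C(n - 1 + 2 * d, 2 * d) * (2 * d)`!)%N.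
  apply/eqP; rewrite -(eqn_pmul2r (fact_gt0 (n - 1))); apply/eqP.
  have h1 := bin_fact (leq_addl (n - 1) d); rewrite addnK in h1.
  have h2 := bin_fact (leq_addl (n - 1) (2 * d)); rewrite addnK in h2.
  have h3 := ffact_fact (leq_addl (d + n - 1) d); rewrite addnK in h3.
  have e1 : (d + n - 1 = n - 1 + d)%N by lia.
  have e2 : (n - 1 + d + d = n - 1 + 2 * d)%N by lia.
  rewrite -[RHS]mulnA h2 /X e1 e2; rewrite e1 e2 in h3.
  by rewrite -h3 -h1; ring.
have {}NX := congr1 (fun k => k%:R : R) NX; rewrite /= !natrM -/N -/C in NX.
have s1 : (-1) ^+ d * (-1) ^+ d = 1 :> R by rewrite -expr2 sqrr_sign.
have C0 : C != 0 by rewrite gt_eqF // C_gt0.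
have F0 := fact_neq0 R (2 * d).
rewrite /= mul1r.
transitivity ((N * X%:R) / (C * ((2 * d)`!)%:R) * ((-1) ^+ d * (-1) ^+ d)).
  by field; rewrite F0 C0.
by rewrite s1 mulr1 [X%:R]natrM NX divff // mulf_neq0.
Qed.

Definition dual_diag : R := N * N / C.
Definition dual_offdiag : R := (-1) ^+ d * N / C.

Lemma dual_power_word i j :
  gram_dual i (power_word j) = if i == j then dual_diag else dual_offdiag.
Proof.
rewrite /gram_dual -/N -/C /power_word /= count_nseq /= eq_sym.
case: eqP => _.
  rewrite mul1n addnn -mul2n exprM sqrrN !expr1n mul1r.
  rewrite (_ : (d + n - 1 = n - 1 + d)%N) -/N /dual_diag; [ring | lia].
by rewrite mul0n addn0 bin0 /dual_offdiag; ring.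
Qed.

Lemma mu_bound_gt0 : 0 < mu_bound R n d.
Proof.
rewrite /mu_bound; case: eqP => // n1.
have N0 := N_gt0; have C0 := C_gt0.
have n2 : 1 < n%:R :> R by rewrite ltr1n; lia.
by case: ifP => _; rewrite divr_gt0 // mulr_gt0 //; lra.
Qed.

Lemma dual_diag1 : n = 1%N -> dual_diag = 1.
Proof. by move=> n1; rewrite /dual_diag /N /C n1 !binn mul1r divr1. Qed.

Lemma mu_bound_odd : (1 < n)%N -> odd d ->
  mu_bound R n d * (dual_diag - dual_offdiag) = 1.
Proof.
move=> n2 od; rewrite /mu_bound gtn_eqF // od /dual_diag /dual_offdiag -signr_odd od -/N -/C.
have N0 := N_gt0; have C0 := C_gt0; field.
by rewrite !gt_eqF //; lra.
Qed.

Lemma mu_bound_even : (1 < n)%N -> ~~ odd d ->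
  mu_bound R n d * (dual_diag + (n%:R - 1) * dual_offdiag) = 1.
Proof.
move=> n2 od; rewrite /mu_bound gtn_eqF // (negPf od) /dual_diag /dual_offdiag.
rewrite -signr_odd (negPf od) -/N -/C.
have N0 := N_gt0; have C0 := C_gt0; field.
have n2' : 1 < n%:R :> R by rewrite ltr1n.
by rewrite !gt_eqF //; lra.
Qed.

Lemma sum_offdiag (V : lmodType R) (y : 'I_n -> V) j :
  \sum_i gram_dual i (power_word j) *: y i
    = (dual_diag - dual_offdiag) *: y j + dual_offdiag *: \sum_i y i.
Proof.
rewrite [in RHS](bigD1 j) //= (bigD1 j) //= dual_power_word eqxx scalerDr addrA.
rewrite -scalerDl subrK scaler_sumr; congr (_ + _); apply: eq_bigr => i /negPf ij.
by rewrite dual_power_word ij.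
Qed.

(** The vector [y] is an eigenvector of the compressed inverse Gram matrix for its
largest eigenvalue; it is what makes the bound sharp. *)
Lemma extremal_vector : exists2 y : 'I_n -> R, \sum_i y i ^+ 2 != 0 &
  forall j, mu_bound R n d * (\sum_i gram_dual i (power_word j) * y i) = y j.
Proof.
have eqs (y : 'I_n -> R) j := @sum_offdiag R^o y j.
have [n1|n_neq1] := eqVneq n 1%N.
  exists (fun=> 1); first by rewrite sumr_const card_ord expr1n pnatr_eq0 -lt0n.
  move=> j; rewrite [X in _ * X](eqs (fun=> 1) j) sumr_const card_ord n1 mulr1n -scalerDl subrK.
  by rewrite dual_diag1 // /mu_bound eqxx scale1r mulr1.
have n2 : (1 < n)%N by rewrite ltn_neqAle eq_sym n_neq1 n_gt0.
have [od|od] := boolP (odd d).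
  pose i0 := Ordinal n_gt0; pose i1 := Ordinal n2.
  exists (fun i => (i == i0)%:R - (i == i1)%:R).
    rewrite (bigD1 i0) //= gt_eqF // ltr_wpDr //; first by rewrite sumr_ge0 // => i _; exact: sqr_ge0.
  move=> j; rewrite [X in _ * X](eqs (fun i => (i == i0)%:R - (i == i1)%:R) j).
  have -> : \sum_(i < n) ((i == i0)%:R - (i == i1)%:R) = 0 :> R.
    by rewrite sumrB (bigD1 i0) //= big1 => [|i /negPf->//];
       rewrite (bigD1 i1) //= big1 => [|i /negPf->//]; rewrite ?eqxx /= !addr0 subrr.
  by rewrite scaler0 addr0 mulrA mu_bound_odd // mul1r.
exists (fun=> 1); first by rewrite sumr_const card_ord expr1n pnatr_eq0 -lt0n.
move=> j; rewrite [X in _ * X](eqs (fun=> 1) j) sumr_const card_ord.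
transitivity (mu_bound R n d * (dual_diag + (n%:R - 1) * dual_offdiag)); last exact: mu_bound_even.
congr (_ * _); rewrite /GRing.scale /=; ring.
Qed.
End GramDual.

(** * Sums of hermitian squares *)

Lemma malgUM (R : nzRingType) (K : monomType) (k1 k2 : K) (a b : R) :
  << a *g k1 >> * << b *g k2 >> = << a * b *g mmul k1 k2 >> :> {malg R[K]}.
Proof. exact: fgmulUU. Qed.

Lemma prod_malgU (R : nzRingType) (K : monomType) I (s : seq I) (f : I -> K) :
  \prod_(i <- s) << f i >> = << \big[mmul/mone]_(i <- s) f i >> :> {malg R[K]}.
Proof.
elim: s => [|x s IH]; first by rewrite !big_nil.
by rewrite !big_cons IH malgUM mulr1.
Qed.

Section Coefficients.
Variables (R : realType) (n : nat).
Implicit Types (w : word n) (m : monomial n) (i : 'I_n).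

Lemma abelianizeE w i : abelianize w i = count_mem i w.
Proof.
rewrite /abelianize; case: w => s /=; elim: s => [|x s IH].
  by rewrite big_nil cm1.
by rewrite big_cons cmM IH cmU.
Qed.

Lemma mdeg_sum m : mdeg m = (\sum_i m i)%N.
Proof.
rewrite mdegE (big_uniq _ (fset_uniq _)) big_mkcond /=; apply: eq_bigr => i _.
by case: mdomP.
Qed.

Lemma mdeg_abelianize w : mdeg (abelianize w) = size w.
Proof. by rewrite mdeg_sum; under eq_bigr do rewrite abelianizeE; rewrite sum_count. Qed.

Lemma eq_abelianize w m : (abelianize w == m) = [forall i, count_mem i w == m i].
Proof.
apply/cmP/forallP => h i; first by rewrite -abelianizeE h.
by rewrite abelianizeE (eqP (h i)).
Qed.

Lemma card_fibre m : (#|fibre m| * \prod_i (m i)`! = (mdeg m)`!)%N.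
Proof.
rewrite -(card_word_count (esym (mdeg_sum m))); congr (_ * _)%N.
by apply: eq_card => t; rewrite !inE eq_abelianize.
Qed.

Lemma card_fibre_gt0 m : (0 < #|fibre m|)%N.
Proof. by have := fact_gt0 (mdeg m); rewrite -card_fibre muln_gt0 => /andP[]. Qed.

Lemma prod_ucm (s : seq 'I_n) :
  \prod_(i <- s) << ucm i >> = << abelianize (FMonom s) >> :> cpoly R n.
Proof. exact: prod_malgU. Qed.

(** Each monomial of degree [d] comes from exactly one sorted word. *)
Lemma mcoeff_hsym d m : (hsym R n d)@_m = (mdeg m == d)%:R.
Proof.
rewrite /hsym raddf_sum /=.
transitivity (\sum_(t : d.-tuple 'I_n | sorted <=%O t)
    ((abelianize (FMonom t) == m)%:R : R)).
  by apply: eq_bigr => t _; rewrite prod_ucm mcoeffU1.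
have [dm|dm] := eqVneq (mdeg m) d; last first.
  rewrite big1 // => t _; case: eqP => // tm.
  by move: dm; rewrite -tm mdeg_abelianize size_tuple eqxx.
have [t0 t0m] : exists t0 : d.-tuple 'I_n, abelianize (FMonom t0) = m.
  rewrite -dm; have /card_gt0P[t0] := card_fibre_gt0 m.
  by rewrite inE => /eqP; exists t0.
pose s := sort_word t0.
have sm : abelianize (FMonom (val s)) = m.
  by rewrite -t0m; apply/eqP/cmP => i; rewrite !abelianizeE /= (count_sort_word t0).
rewrite (bigD1 (val s)) /=; last exact: (valP s).
rewrite sm eqxx big1 ?addr0 // => t /andP[st ts]; case: eqP => // tm.
case/negP: ts; apply/eqP.
suff : exist (fun t : d.-tuple 'I_n => is_true (sorted <=%O t)) _ st = s.
  by move=> /(congr1 val).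
apply: multiset_wordP => i /=.
by have := congr1 (fun m : monomial n => m i) (etrans tm (esym sm)); rewrite !abelianizeE.
Qed.

Lemma mcoeff_symmetrize (p : cpoly R n) w :
  (symmetrize p)@_w = p@_(abelianize w) / #|fibre (abelianize w)|%:R.
Proof.
rewrite /symmetrize raddf_sum /=.
have fib m : (\sum_(t in fibre m) << FMonom (tval t) >> : ncpoly R n)@_w = (abelianize w == m)%:R.
  rewrite raddf_sum /=.
  have [/fibreP[t tm wt]|wm] := eqVneq (abelianize w) m.
    rewrite (bigD1 t) //= mcoeffU1 wt eqxx big1 ?addr0 // => t' /andP[_ t't].
    rewrite mcoeffU1; case: eqP => // -[] /val_inj tt'.
    by rewrite tt' eqxx in t't.
  rewrite big1 // => t tm; rewrite mcoeffU1; case: eqP => // tw.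
  by case/negP: wm; apply/eqP/fibreP; exists t.
transitivity (\sum_(m <- msupp p) p@_m * (#|fibre m|%:R^-1 * (abelianize w == m)%:R)).
  by apply: eq_bigr => m _; rewrite !mcoeffZ fib.
have [wp|wp] := boolP (abelianize w \in msupp p); last first.
  rewrite (mcoeff_outdom wp) mul0r big_seq big1 // => m mp.
  by case: eqP => [wm|_]; [rewrite wm mp in wp | rewrite !mulr0].
rewrite (big_fsetD1 _ wp) /= eqxx mulr1 big_seq big1 ?addr0 // => m.
by rewrite in_fsetD1 eq_sym => /andP[/negPf-> _]; rewrite !mulr0.
Qed.

Lemma mcoeff_Hsym d w : (Hsym R n d)@_w =
  if size w == d then (\prod_i (count_mem i w)`!)%:R / (d`!)%:R else 0.
Proof.
rewrite mcoeff_symmetrize mcoeff_hsym.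
have := card_fibre (abelianize w); have := card_fibre_gt0 (abelianize w).
set c := #|_|; rewrite mdeg_abelianize => c_gt0 cE.
case: eqP => [<-|_]; last by rewrite mul0r.
rewrite -cE; under [in RHS]eq_bigr do rewrite -abelianizeE.
rewrite natrM mul1r invfM mulrCA divff ?mulr1 //.
by rewrite pnatr_eq0 -lt0n prodn_gt0 // => i; rewrite fact_gt0.
Qed.

Lemma mcoeff_ncstar (p : ncpoly R n) w : (ncstar p)@_w = p@_(FMonom (rev w)).
Proof.
rewrite /ncstar raddf_sum /=; set w' := FMonom (rev w).
have E (k : word n) : (FMonom (rev k) == w) = (k == w').
  apply/eqP/eqP => [e|->]; last by rewrite /= revK; case: w @w'.
  by rewrite /w' -e /= revK; case: k {e}.
transitivity (\sum_(k <- msupp p) p@_k * (k == w')%:R).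
  by apply: eq_bigr => k _; rewrite mcoeffZ mcoeffU1 E.
have [wp|wp] := boolP (w' \in msupp p); last first.
  rewrite (mcoeff_outdom wp) big_seq big1 // => k kp.
  by case: eqP => [wm|_]; [rewrite -wm kp in wp | rewrite mulr0].
rewrite (big_fsetD1 _ wp) /= eqxx mulr1 big_seq big1 ?addr0 // => k.
by rewrite in_fsetD1 => /andP[/negPf-> _]; rewrite mulr0.
Qed.

Lemma scale_malgU (K : choiceType) (c : R) (k : K) :
  c *: << k >> = << c *g k >> :> {malg R[K]}.
Proof. by apply/malgP => k'; rewrite mcoeffZ !mcoeffU mulr_natr. Qed.

Lemma HsymE d : Hsym R n (2 * d) =
  \sum_(u : d.-tuple 'I_n) \sum_(v : d.-tuple 'I_n)
     gram R d u v *: << FMonom (rev u ++ v) >>.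
Proof.
apply/malgP => w; rewrite mcoeff_Hsym raddf_sum /=.
transitivity (\sum_(u : d.-tuple 'I_n) \sum_(v : d.-tuple 'I_n)
     gram R d u v * (rev u ++ v == w)%:R); last first.
  apply: eq_bigr => u _; rewrite raddf_sum /=; apply: eq_bigr => v _.
  by rewrite mcoeffZ mcoeffU1.
case: (size w =P (2 * d)%N) => sw; last first.
  rewrite big1 // => u _; rewrite big1 // => v _; case: eqP => [e|]; last by rewrite mulr0.
  by case: sw; rewrite -e size_cat size_rev !size_tuple mul2n addnn.
have su : size (rev (take d w)) == d by rewrite size_rev size_takel // sw; lia.
have sv : size (drop d w) == d by rewrite size_drop sw; lia.
rewrite (bigD1 (Tuple su)) //= (bigD1 (Tuple sv)) //= revK cat_take_drop eqxx.
rewrite [X in _ = _ + X + _]big1 => [|v vv]; last first.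
  case: eqP => [e|]; last by rewrite mulr0.
  case/negP: vv; apply/eqP; apply: val_inj => /=.
  by rewrite -e drop_size_cat // size_takel // sw; lia.
rewrite [X in _ = _ + X]big1 => [|u uu].
  rewrite !addr0 mulr1 /gram; congr (_%:R / _); apply: eq_bigr => i _ /=.
  by rewrite count_rev -count_cat cat_take_drop.
rewrite big1 // => v _; case: eqP => [e|]; last by rewrite mulr0.
case/negP: uu; apply/eqP; apply: val_inj => /=.
by rewrite -e take_size_cat ?revK // size_rev size_tuple.
Qed.

End Coefficients.

Section SumOfSquares.
Variables (R : realType) (n d : nat).
Hypotheses (n_gt0 : (0 < n)%N).
Local Notation S := (multiset_word n d).

Let e (k : 'I_#|{: S}|) : S := enum_val k.

Let e_bij : bijective e.
Proof. by exists enum_rank; [exact: enum_valK | exact: enum_rankK]. Qed.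

Let gram_mx : 'M[R]_#|{: S}| :=
  \matrix_(k < #|{: S}|, l < #|{: S}|)
     gram R d (val (e k)) (val (e l)).

Lemma gram_mx_form (z : 'rV[R]_#|{: S}|) :
  (z *m gram_mx *m z^T) 0 0 = \sum_(s : S) \sum_(t : S)
    gram R d (val s) (val t) * z 0 (enum_rank s) * z 0 (enum_rank t).
Proof.
rewrite mxE exchange_big /= (reindex e) /=; last exact: onW_bij e_bij.
apply: eq_bigr => k _; rewrite !mxE mulr_suml (reindex e) /=; last exact: onW_bij e_bij.
by apply: eq_bigr => l _; rewrite !mxE /e !enum_valK; ring.
Qed.

Lemma gram_mx_definite (z : 'rV[R]_#|{: S}|) :
  (z *m gram_mx *m z^T) 0 0 <= 0 -> z = 0.
Proof.
rewrite gram_mx_form => /(gram_posdef (z := fun s => z 0 (enum_rank s))) z0.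
by apply/rowP => k; rewrite mxE -(z0 (e k)) enum_valK.
Qed.

Lemma mul_ncstar_words (a b : d.-tuple 'I_n -> R) :
  ncstar (\sum_u a u *: << FMonom (tval u) >>) * (\sum_v b v *: << FMonom (tval v) >>) =
  \sum_u \sum_v (a u * b v) *: << FMonom (rev u ++ v) >>.
Proof.
have -> : ncstar (\sum_u a u *: << FMonom (tval u) >>) =
    \sum_u a u *: << FMonom (rev (tval u)) >>.
  apply/malgP => w; rewrite mcoeff_ncstar !raddf_sum /=; apply: eq_bigr => u _.
  rewrite !mcoeffZ !mcoeffU1; congr (_ * _%:R); congr (nat_of_bool _).
  apply/eqP/eqP => [[->]|<-]; last by rewrite /= revK.
  by rewrite revK; case: w.
rewrite mulr_suml; apply: eq_bigr => u _; rewrite mulr_sumr; apply: eq_bigr => v _.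
rewrite !scale_malgU malgUM; congr (<< _ *g _ >>).
by apply: val_inj; rewrite /= fmM.
Qed.

Lemma Hsym_sum_of_squares : exists q : 'I_('C(n - 1 + d, d)) -> ncpoly R n,
  Hsym R n (2 * d) = \sum_j ncstar (q j) * q j.
Proof.
rewrite -(card_multiset_word d n_gt0).
have [||Q QE] := @cholesky R _ gram_mx.
- by apply/matrixP => k l; rewrite !mxE gramC.
- move=> z z0; rewrite ltNge; apply: contra z0 => /gram_mx_definite ->.
  by rewrite eqxx.
pose a k (u : d.-tuple 'I_n) := Q k (enum_rank (sort_word u)).
exists (fun k => \sum_u a k u *: << FMonom (tval u) >>).
under eq_bigr do rewrite mul_ncstar_words.
rewrite exchange_big HsymE /=; apply: eq_bigr => u _.
rewrite exchange_big /=; apply: eq_bigr => v _.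
have -> : gram R d u v = \sum_k a k u * a k v; last exact: scaler_suml.
have := congr1 (fun M : 'M[R]_#|{: S}| => M (enum_rank (sort_word u)) (enum_rank (sort_word v))) QE.
rewrite !mxE /e !enum_rankK gram_sort => ->; apply: eq_bigr => k _.
by rewrite mxE.
Qed.

(** In degree [2 * D], only the factorization of [rev u ++ v] into two words of
length [D] contributes to the product of polynomials of degree at most [D]. *)
Lemma mcoeff_top_product D (p q : ncpoly R n) (u v : D.-tuple 'I_n) :
  (forall w : word n, (D < size w)%N -> p@_w = 0) ->
  (forall w : word n, (D < size w)%N -> q@_w = 0) ->
  (ncstar p * q)@_(FMonom (rev u ++ v)) = p@_(FMonom u) * q@_(FMonom v).
Proof.
move=> pD qD; set u' : word n := FMonom (rev u); set v' : word n := FMonom v.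
rewrite (@mcoeffMlw _ _ ([fset u'] `|` msupp (ncstar p))%fset ([fset v'] `|` msupp q)%fset);
  [|exact: fsubsetUr..].
have coef0 (k1 k2 : word n) : (k1 != u') || (k2 != v') ->
    ((ncstar p)@_k1 * q@_k2) *+ (mmul k1 k2 == FMonom (rev u ++ v)) = 0.
  move=> k12; case: eqP => // /(congr1 val) /=; rewrite fmM => kuv.
  have se : (size k1 + size k2 = D + D)%N.
    by rewrite -size_cat kuv size_cat size_rev !size_tuple.
  have [k1D|k1D|k1D] := ltngtP (size k1) D.
  - by rewrite (qD k2) ?mulr0 //; lia.
  - by rewrite mcoeff_ncstar (pD (FMonom (rev k1))) ?mul0r //= size_rev.
  move/eqP: kuv; rewrite eqseq_cat ?size_rev ?size_tuple // => /andP[/eqP e1 /eqP e2].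
  by move: k12; rewrite -negb_and => /negP[]; apply/andP; split; apply/eqP/val_inj.
rewrite (big_fsetD1 u') ?in_fsetU ?in_fset1 ?eqxx //= (big_fsetD1 v') ?in_fsetU ?in_fset1 ?eqxx //=.
rewrite (_ : mmul u' v' = FMonom (rev u ++ v)); last by apply: val_inj; rewrite /= fmM.
rewrite eqxx [X in _ + X + _]big_seq [X in _ + X + _]big1 => [|k]; last first.
  by rewrite in_fsetD1 => /andP[kv _]; rewrite coef0 // kv orbT.
rewrite [X in _ + X]big_seq [X in _ + X]big1 => [|k]; last first.
  rewrite in_fsetD1 => /andP[ku _].
  by rewrite big1 // => k2 _; rewrite coef0 // ku.
by rewrite !addr0 mcoeff_ncstar /= revK.
Qed.

(** The degree of the [q j] is at most [d]: at a word [w] of larger, maximal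
length [D.+1] the coefficient of [rev w ++ w] is [\sum_j (q j)@_w ^+ 2], and it
is zero. Then the coefficients of the [q j] at words of length [d] factor the
invertible Gram matrix through a space of dimension [r]. *)
Lemma Hsym_squares_minimal r (q : 'I_r -> ncpoly R n) :
  Hsym R n (2 * d) = \sum_j ncstar (q j) * q j -> ('C(n - 1 + d, d) <= r)%N.
Proof.
move=> Hq.
have degree_drop D : (d <= D)%N ->
    (forall j (w : word n), (D.+1 < size w)%N -> (q j)@_w = 0) ->
    (forall j (w : word n), (D < size w)%N -> (q j)@_w = 0).
  move=> dD qD j w; rewrite leq_eqVlt => /orP[/eqP sw|]; last exact: qD.
  have sw' : size w == D.+1 by rewrite -sw.
  pose u := Tuple sw'.
  have := congr1 (mcoeff (FMonom (rev u ++ u))) Hq.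
  rewrite mcoeff_Hsym /= size_cat size_rev -sw ifN; last by lia.
  rewrite raddf_sum /= => /esym/eqP; rewrite psumr_eq0.
    move=> /allP/(_ j); rewrite mem_index_enum => /(_ isT) /=.
    rewrite (mcoeff_top_product u u (qD j) (qD j)) mulf_eq0 orbb => /eqP.
    by rewrite /u /=; case: w {sw sw' u}.
  by move=> k _; rewrite (mcoeff_top_product u u (qD k) (qD k)) -expr2 sqr_ge0.
have [D0 qD0] : exists D0, forall j (w : word n), (D0 < size w)%N -> (q j)@_w = 0.
  exists (\max_j mmeasure (@fdeg _) (q j)) => j w sw; apply: mcoeff_outdom.
  apply: (@mmeasure_mnm_ge _ _ (@fdeg _)); apply: leq_trans (ltnW sw).
  exact: (leq_bigmax (F := fun j => mmeasure (@fdeg _) (q j)) j).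
have {D0 qD0} qd j (w : word n) : (d < size w)%N -> (q j)@_w = 0.
  have : forall k j (w : word n), (d + (D0 - k) < size w)%N -> (q j)@_w = 0.
    elim=> [|k IH] {}j {}w; first by rewrite subn0 => ?; apply: qD0; lia.
    case: (ltnP k D0) => kD; last first.
      by move=> ?; apply: IH; lia.
    apply: degree_drop; first by lia.
    by move=> j' w' ?; apply: IH; lia.
  by move=> /(_ D0 j w); rewrite subnn addn0.
pose A : 'M[R]_(r, #|{: S}|) := \matrix_(j, k) (q j)@_(FMonom (tval (val (e k)))).
have AE : gram_mx = A^T *m A.
  apply/matrixP => k l; rewrite !mxE.
  have := congr1 (mcoeff (FMonom (rev (val (e k)) ++ (val (e l))))) Hq.
  rewrite mcoeff_Hsym /= size_cat size_rev !size_tuple ifT; last by apply/eqP; lia.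
  rewrite raddf_sum /gram => co; transitivity (\sum_j (q j)@_(FMonom (tval (val (e k)))) *
     (q j)@_(FMonom (tval (val (e l))))); last by apply: eq_bigr => j _; rewrite !mxE.
  under [RHS]eq_bigr do rewrite -(mcoeff_top_product _ _ (qd _) (qd _)).
  rewrite -co; congr (_%:R / _); apply: eq_bigr => i _ /=.
  by rewrite count_cat count_rev.
have : row_free gram_mx.
  rewrite -kermx_eq0; apply/eqP/row_matrixP => k; rewrite row0.
  by apply: gram_mx_definite; rewrite -row_mul mulmx_ker row0 mul0mx mxE.
rewrite /row_free => /eqP rk; rewrite -card_multiset_word // -rk.
by rewrite AE (leq_trans (mxrankM_maxl _ _)) // rank_leq_col.
Qed.
End SumOfSquares.

(** * The lower bound for self-adjoint operators *)

Section Evaluation.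
Variables (R : realType) (K : numFieldType) (conj : K -> K) (iota : {rmorphism R -> K}).
Hypothesis conj_iota : forall x, conj (iota x) = iota x.
Variable V : hilbertSpace conj.
Implicit Types u v : V.
Local Notation "''<|' u , v '|>'" := (inner V u v) (at level 0, u, v at level 99).

Lemma inner_ge0 v : 0 <= '<|v, v|>.
Proof. by rewrite -inner_norm exprn_ge0. Qed.

Lemma inner_suml I (r : seq I) (P : pred I) F v :
  '<|\sum_(i <- r | P i) F i, v|> = \sum_(i <- r | P i) '<|F i, v|>.
Proof. exact: linear_sumlz. Qed.

Lemma inner_sumr I (r : seq I) (P : pred I) F v :
  '<|v, \sum_(i <- r | P i) F i|> = \sum_(i <- r | P i) '<|v, F i|>.
Proof. exact: linear_sumr. Qed.

Lemma innerBl u v x : '<|u - v, x|> = '<|u, x|> - '<|v, x|>.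
Proof. exact: linearBl. Qed.

Lemma innerBr u v x : '<|x, u - v|> = '<|x, u|> - '<|x, v|>.
Proof. exact: linearBr. Qed.

Lemma innerDr u v x : '<|x, u + v|> = '<|x, u|> + '<|x, v|>.
Proof. exact: linearDr. Qed.

Lemma innerZl a u v : '<|a *: u, v|> = a * '<|u, v|>.
Proof. exact: linearZl_LR. Qed.

Lemma innerZr a u v : '<|u, iota a *: v|> = iota a * '<|u, v|>.
Proof. by rewrite linearZr_LR /= conj_iota. Qed.

Variables (n : nat) (X : 'I_n -> {linear V -> V}).
Hypothesis self_adjoint_X : forall i, self_adjoint (X i).

Lemma word_eval_cat (s t : seq 'I_n) v :
  word_eval X (FMonom (s ++ t)) v = word_eval X (FMonom s) (word_eval X (FMonom t) v).
Proof. by rewrite /word_eval /=; elim: s => //= i s ->. Qed.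

Lemma word_eval_adjoint (s : seq 'I_n) u v :
  '<|word_eval X (FMonom s) u, v|> = '<|u, word_eval X (FMonom (rev s)) v|>.
Proof.
elim: s u v => [|i s IH] u v //.
rewrite rev_cons -cats1 word_eval_cat -IH.
by rewrite /word_eval /= self_adjoint_X.
Qed.

Lemma word_eval_nseq k i v : word_eval X (FMonom (nseq k i)) v = iter k (X i) v.
Proof. by rewrite /word_eval /=; elim: k => //= k ->. Qed.

Lemma nc_evalEw (p : ncpoly R n) (D : {fset word n}) v : (msupp p `<=` D)%fset ->
  nc_eval iota X p v = \sum_(w <- D) iota p@_w *: word_eval X w v.
Proof.
move=> pD; rewrite /nc_eval (big_fset_incl _ pD) //= => w _ /mcoeff_outdom ->.
by rewrite rmorph0 scale0r.
Qed.

Lemma nc_evalD (p q : ncpoly R n) v :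
  nc_eval iota X (p + q) v = nc_eval iota X p v + nc_eval iota X q v.
Proof.
rewrite (nc_evalEw v (msuppD_le p q)) (nc_evalEw v (fsubsetUl (msupp p) (msupp q))).
rewrite (nc_evalEw v (fsubsetUr (msupp p) (msupp q))) -big_split /=.
by apply: eq_bigr => w _; rewrite mcoeffD rmorphD scalerDl.
Qed.

Lemma nc_evalZ a w v : nc_eval iota X (a *: << w >> : ncpoly R n) v = iota a *: word_eval X w v.
Proof.
rewrite scale_malgU (nc_evalEw v (msuppU_le (k := w))) big_seq_fset1.
by rewrite mcoeffUU.
Qed.

Lemma nc_eval_sum I (r : seq I) (F : I -> ncpoly R n) v :
  nc_eval iota X (\sum_(i <- r) F i) v = \sum_(i <- r) nc_eval iota X (F i) v.
Proof.
apply: (big_morph (fun p => nc_eval iota X p v)) => [p q|]; first exact: nc_evalD.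
by rewrite /nc_eval msupp0 big_seq_fset0.
Qed.

(** The Gram matrix of [Hsym] becomes a form in the vectors obtained by applying
the words of length [d]. *)
Lemma inner_nc_eval_Hsym d u v :
  '<|nc_eval iota X (Hsym R n (2 * d)) u, v|> =
  \sum_(s : d.-tuple 'I_n) \sum_(t : d.-tuple 'I_n)
    iota (gram R d s t) * '<|word_eval X (FMonom t) u, word_eval X (FMonom s) v|>.
Proof.
rewrite HsymE nc_eval_sum inner_suml; apply: eq_bigr => s _.
rewrite nc_eval_sum inner_suml; apply: eq_bigr => t _.
by rewrite nc_evalZ innerZl word_eval_cat word_eval_adjoint revK.
Qed.

Lemma inner_power_sum d u v :
  '<|\sum_i iter (2 * d) (X i) u, v|> =
  \sum_i '<|word_eval X (FMonom (power_word d i)) u, word_eval X (FMonom (power_word d i)) v|>.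
Proof.
rewrite inner_suml; apply: eq_bigr => i _.
rewrite word_eval_adjoint rev_nseq !word_eval_nseq.
have adj k x y : '<|iter k (X i) x, y|> = '<|x, iter k (X i) y|>.
  by elim: k x y => //= k IH x y; rewrite self_adjoint_X IH -iterS iterSr.
by rewrite adj mul2n -addnn iterD.
Qed.

Lemma self_adjoint_difference d (mu : R) :
  self_adjoint (fun v => nc_eval iota X (Hsym R n (2 * d)) v
                         - iota mu *: \sum_(i < n) iter (2 * d) (X i) v).
Proof.
move=> u v; rewrite innerBl innerBr innerZl innerZr; congr (_ - _ * _).
  rewrite inner_nc_eval_Hsym HsymE nc_eval_sum inner_sumr exchange_big /=.
  apply: eq_bigr => t _; rewrite nc_eval_sum inner_sumr.
  apply: eq_bigr => s _; rewrite nc_evalZ innerZr gramC; congr (_ * _).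
  by rewrite word_eval_cat word_eval_adjoint.
rewrite inner_power_sum inner_sumr; apply: eq_bigr => i _.
rewrite word_eval_adjoint rev_nseq !word_eval_nseq.
by rewrite -iterD mul2n addnn.
Qed.

Hypothesis iota_ge0 : forall x, 0 <= x -> 0 <= iota x.

Lemma gram_form_ge0 d (z : d.-tuple 'I_n -> V) :
  0 <= \sum_(s : d.-tuple 'I_n) \sum_(t : d.-tuple 'I_n) iota (gram R d s t) * '<|z t, z s|>.
Proof.
pose F k := \sum_(s : d.-tuple 'I_n) iota (feature R (d := d) k s) *: z s.
have -> : \sum_(s : d.-tuple 'I_n) \sum_(t : d.-tuple 'I_n) iota (gram R d s t) * '<|z t, z s|> =
    iota (((2 * d)`!)%:R^-1) * \sum_k '<|F k, F k|>.
  rewrite mulr_sumr.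
  transitivity (\sum_(s : d.-tuple 'I_n) \sum_(t : d.-tuple 'I_n) \sum_k iota (((2 * d)`!)%:R^-1) *
     (iota (feature R (d := d) k s) * iota (feature R (d := d) k t) * '<|z t, z s|>)).
    apply: eq_bigr => s _; apply: eq_bigr => t _.
    rewrite gram_feature rmorphM rmorph_sum -mulrA mulr_suml mulr_sumr.
    by apply: eq_bigr => k _; rewrite rmorphM.
  under eq_bigr do rewrite exchange_big /=.
  rewrite exchange_big /=; apply: eq_bigr => k _.
  rewrite inner_sumr mulr_sumr; apply: eq_bigr => s _.
  rewrite innerZr inner_suml !mulr_sumr; apply: eq_bigr => t _.
  by rewrite innerZl; ring.
rewrite mulr_ge0 ?iota_ge0 ?invr_ge0 ?ler0n // sumr_ge0 // => k _.
exact: inner_ge0.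
Qed.

Variable d : nat.
Hypotheses (n_gt0 : (0 < n)%N) (d_gt0 : (0 < d)%N).
Let mu := mu_bound R n d.

(** The difference of the two sides is half the sum of all [|y i - y j| ^ 2]. *)
Lemma norm_sum_le (y : 'I_n -> V) :
  '<|\sum_i y i, \sum_i y i|> <= n%:R * \sum_i '<|y i, y i|>.
Proof.
rewrite -subr_ge0 -(pmulr_rge0 _ (ltr0n K 2)).
have -> : 2 * (n%:R * \sum_i '<|y i, y i|> - '<|\sum_i y i, \sum_i y i|>) =
   \sum_i \sum_j '<|y i - y j, y i - y j|>.
  transitivity (\sum_i \sum_j ('<|y i, y i|> + '<|y j, y j|> - '<|y i, y j|> - '<|y j, y i|>)).
    have E1 : \sum_(i < n) \sum_(j < n) '<|y i, y i|> = n%:R * \sum_i '<|y i, y i|>.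
      rewrite mulr_sumr; apply: eq_bigr => i _.
      by rewrite sumr_const card_ord mulr_natl.
    have E2 : \sum_(i < n) \sum_(j < n) '<|y j, y j|> = n%:R * \sum_i '<|y i, y i|>.
      by rewrite sumr_const card_ord mulr_natl.
    have E3 : \sum_(i < n) \sum_(j < n) '<|y i, y j|> = '<|\sum_i y i, \sum_i y i|>.
      by rewrite inner_suml; apply: eq_bigr => i _; rewrite inner_sumr.
    under [RHS]eq_bigr do rewrite !sumrB big_split /=.
    rewrite !sumrB big_split /= E1 E2 E3 exchange_big /= E3; ring.
  apply: eq_bigr => i _; apply: eq_bigr => j _.
  by rewrite innerBl !innerBr; ring.
by apply: sumr_ge0 => i _; apply: sumr_ge0 => j _; exact: inner_ge0.
Qed.

Let a := dual_diag R n d.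
Let b := dual_offdiag R n d.

(** The largest eigenvalue of the compressed inverse Gram matrix is
[mu_bound R n d]^-1. For odd [d] the off-diagonal entry is negative and the term
in [\sum_i y i] can be dropped; for even [d] it is bounded by [norm_sum_le]. *)
Lemma dual_form_le (y : 'I_n -> V) :
  iota mu * (iota (a - b) * (\sum_i '<|y i, y i|>) + iota b * '<|\sum_i y i, \sum_i y i|>)
    <= \sum_i '<|y i, y i|>.
Proof.
set Y := \sum_i '<|y i, y i|>; set S := '<|_, _|>.
have Y0 : 0 <= Y by apply: sumr_ge0 => i _; exact: inner_ge0.
have S0 : 0 <= S by exact: inner_ge0.
have mu0 : 0 <= iota mu by apply/iota_ge0/ltW/mu_bound_gt0.
have [n1|n_neq1] := eqVneq n 1%N.
  have -> : S = Y.
    rewrite /S /Y; have [i0 iE] : exists i0 : 'I_n, forall i, i = i0.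
      by exists (Ordinal n_gt0) => i; apply: val_inj => /=; have := ltn_ord i; lia.
    have E (W : nmodType) (F : 'I_n -> W) : \sum_i F i = F i0.
      by rewrite (bigD1 i0) //= big1 ?addr0 // => i; rewrite (iE i) eqxx.
    by rewrite !E.
  rewrite -mulrDl -rmorphD subrK mulrA -rmorphM /a dual_diag1 // mulr1.
  by rewrite /mu /mu_bound n1 eqxx rmorph1 mul1r.
have n2 : (1 < n)%N by rewrite ltn_neqAle eq_sym n_neq1 n_gt0.
have [od|od] := boolP (odd d).
  rewrite mulrDr mulrA -rmorphM (mu_bound_odd R n2 od) rmorph1 mul1r gerDl.
  rewrite mulr_ge0_le0 // mulr_le0_ge0 // -oppr_ge0 -rmorphN iota_ge0 //.
  rewrite /b /dual_offdiag -signr_odd od expr1 mulN1r mulNr opprK.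
  by rewrite divr_ge0 ?ler0n.
have b0 : 0 <= iota b.
  rewrite iota_ge0 // /b /dual_offdiag -signr_odd (negPf od) expr0 mul1r.
  by rewrite divr_ge0 ?ler0n.
apply: (@le_trans _ _ (iota mu * (iota (a - b) * Y + iota b * (n%:R * Y)))).
  by apply: ler_wpM2l => //; rewrite lerD2l; apply: ler_wpM2l => //; exact: norm_sum_le.
rewrite (_ : _ * _ = iota (mu * (a + (n%:R - 1) * b)) * Y).
  by rewrite (mu_bound_even R n2 od) rmorph1 mul1r.
rewrite !(rmorphM, rmorphD, rmorphN, rmorph1, rmorph_nat); ring.
Qed.

(** Bessel's inequality: with [w] the combination of the dual vectors with
coefficients the values [y i] of [z] at the pure powers, the form at
[z - mu * w] is nonnegative, and its cross terms are [\sum_i |y i| ^ 2] by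
duality. *)
Lemma power_sum_bound_form (z : d.-tuple 'I_n -> V) :
  iota mu * \sum_i '<|z (power_word d i), z (power_word d i)|> <=
  \sum_(s : d.-tuple 'I_n) \sum_(t : d.-tuple 'I_n) iota (gram R d s t) * '<|z t, z s|>.
Proof.
pose y i := z (power_word d i).
pose w (t : d.-tuple 'I_n) := \sum_i iota (gram_dual R d i (tval t)) *: y i.
pose B (f g : d.-tuple 'I_n -> V) :=
  \sum_(s : d.-tuple 'I_n) \sum_(t : d.-tuple 'I_n) iota (gram R d s t) * '<|f t, g s|>.
pose Y := \sum_i '<|y i, y i|>.
have ip_dual (s : d.-tuple 'I_n) i :
    \sum_(t : d.-tuple 'I_n) iota (gram R d s t) * iota (gram_dual R d i t) =
    (s == power_word d i)%:R.
  rewrite -[RHS](rmorph_nat iota) -sum_gram_dual // rmorph_sum.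
  by apply: eq_bigr => t _; rewrite -rmorphM.
have Bw g : B w g = \sum_i '<|y i, g (power_word d i)|>.
  transitivity (\sum_(s : d.-tuple 'I_n) \sum_i (s == power_word d i)%:R * '<|y i, g s|>).
    apply: eq_bigr => s _; transitivity (\sum_(t : d.-tuple 'I_n) \sum_i
       (iota (gram R d s t) * iota (gram_dual R d i t)) * '<|y i, g s|>).
      apply: eq_bigr => t _; rewrite /w inner_suml mulr_sumr; apply: eq_bigr => i _.
      by rewrite innerZl mulrA.
    by rewrite exchange_big /=; apply: eq_bigr => i _; rewrite -mulr_suml ip_dual.
  rewrite exchange_big /=; apply: eq_bigr => i _.
  rewrite (bigD1 (power_word d i)) //= eqxx mul1r big1 ?addr0 // => s /negPf ->.
  by rewrite mul0r.
have Bwr f : B f w = \sum_i '<|f (power_word d i), y i|>.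
  rewrite /B exchange_big /=.
  transitivity (\sum_(t : d.-tuple 'I_n) \sum_i (t == power_word d i)%:R * '<|f t, y i|>).
    apply: eq_bigr => t _; transitivity (\sum_(s : d.-tuple 'I_n) \sum_i
       (iota (gram R d t s) * iota (gram_dual R d i s)) * '<|f t, y i|>).
      apply: eq_bigr => s _; rewrite /w inner_sumr mulr_sumr; apply: eq_bigr => i _.
      by rewrite innerZr mulrA gramC.
    by rewrite exchange_big /=; apply: eq_bigr => i _; rewrite -mulr_suml ip_dual.
  rewrite exchange_big /=; apply: eq_bigr => i _.
  rewrite (bigD1 (power_word d i)) //= eqxx mul1r big1 ?addr0 // => t /negPf ->.
  by rewrite mul0r.
have := gram_form_ge0 (fun t => z t - iota mu *: w t).
rewrite -/(B _ _).
have -> : B (fun t => z t - iota mu *: w t) (fun t => z t - iota mu *: w t) =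
   B z z - iota mu * B w z - iota mu * B z w + iota mu * (iota mu * B w w).
  rewrite /B !mulr_sumr -!sumrB -big_split /=; apply: eq_bigr => s _.
  rewrite !mulr_sumr -!sumrB -big_split /=; apply: eq_bigr => t _.
  by rewrite innerBl !innerBr !innerZl !innerZr; ring.
rewrite !Bw Bwr -/Y.
have wE j : w (power_word d j) = iota (a - b) *: y j + iota b *: \sum_i y i.
  rewrite /w [in RHS](bigD1 j) //= (bigD1 j) //= dual_power_word // eqxx.
  rewrite scalerDr addrA -scalerDl -rmorphD subrK scaler_sumr; congr (_ + _).
  by apply: eq_bigr => i /negPf ij; rewrite dual_power_word // ij.
have -> : \sum_i '<|y i, w (power_word d i)|> =
   iota (a - b) * Y + iota b * '<|\sum_i y i, \sum_i y i|>.
  rewrite inner_suml !mulr_sumr -big_split /=; apply: eq_bigr => i _.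
  by rewrite wE innerDr !innerZr.
have mu0 : 0 <= iota mu by apply/iota_ge0/ltW/mu_bound_gt0.
have := ler_wpM2l mu0 (dual_form_le y); rewrite -/Y => h1 h2.
rewrite -/(B z z) -[X in X <= _]/(iota mu * Y) -subr_ge0.
apply: le_trans h2 _; rewrite -subr_ge0.
move: h1; rewrite -subr_ge0; congr (_ <= _); ring.
Qed.

End Evaluation.

Lemma mu_bound_power_sum_bound (R : realType) (K : numFieldType) (conj : K -> K)
    (iota : {rmorphism R -> K}) (n d : nat) :
  (forall x, conj (iota x) = iota x) -> (forall x, 0 <= x -> 0 <= iota x) ->
  (0 < n)%N -> (0 < d)%N ->
  power_sum_bound conj iota n d (mu_bound R n d).
Proof.
move=> conj_iota iota_ge0 n_gt0 d_gt0 V X /all_and2[_ saX]; split.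
  exact: self_adjoint_difference.
move=> v; rewrite innerBl innerZl inner_nc_eval_Hsym // inner_power_sum // subr_ge0.
exact: (power_sum_bound_form conj_iota iota_ge0 n_gt0 d_gt0
  (fun t : d.-tuple 'I_n => word_eval X (FMonom t) v)).
Qed.

(** * Finite-dimensional Hilbert spaces *)

(** What is needed of the real and of the complex numbers to make the space of
finite families a Hilbert space over them. *)
Record scalars := Scalars {
  scalar_field :> numFieldType;
  scalar_conj : {rmorphism scalar_field -> scalar_field};
  scalar_conjK : involutive scalar_conj;
  mul_scalar_conj : forall x, x * scalar_conj x = `|x| ^+ 2;
  scalar_sqrt : scalar_field -> scalar_field;
  scalar_sqrt_ge0 : forall x, 0 <= x -> 0 <= scalar_sqrt x;
  sqr_scalar_sqrt : forall x, 0 <= x -> scalar_sqrt x ^+ 2 = x;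
  scalar_complete : forall F : set_system scalar_field,
    ProperFilter F -> cauchy F -> cvg F
}.

(** A new name for the function space, so that it can carry the Euclidean norm. *)
Definition euclid (S : scalars) (I : finType) : Type := {ffun I -> S^o}.

HB.instance Definition _ S I :=
  GRing.Lmodule.copy (euclid S I) {ffun I -> (S : scalars)^o}.

Section Euclid.
Variables (S : scalars) (I : finType).
Local Notation V := (euclid S I).
Implicit Types u v : V.

Definition l2norm v : S := scalar_sqrt (\sum_i `|v i| ^+ 2).

Lemma l2norm_ge0 v : 0 <= l2norm v.
Proof.
by apply: scalar_sqrt_ge0; rewrite sumr_ge0 // => i _; rewrite exprn_ge0.
Qed.

Lemma sqr_l2norm v : l2norm v ^+ 2 = \sum_i `|v i| ^+ 2.
Proof.
by apply: sqr_scalar_sqrt; rewrite sumr_ge0 // => i _; rewrite exprn_ge0.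
Qed.

Lemma ler_sqr_nneg (x y : S) : 0 <= x -> 0 <= y -> (x ^+ 2 <= y ^+ 2) = (x <= y).
Proof. by move=> x0 y0; rewrite ler_pXn2r. Qed.

Lemma cauchy_schwarz_sum u v : \sum_i `|u i| * `|v i| <= l2norm u * l2norm v.
Proof.
have h0 : 0 <= \sum_i `|u i| * `|v i| by rewrite sumr_ge0 // => i _; rewrite mulr_ge0.
rewrite -ler_sqr_nneg ?mulr_ge0 ?l2norm_ge0 // exprMn !sqr_l2norm.
rewrite -subr_ge0 -(pmulr_rge0 _ (ltr0n S 2)).
have -> : 2 * ((\sum_i `|u i| ^+ 2) * (\sum_i `|v i| ^+ 2) - (\sum_i `|u i| * `|v i|) ^+ 2)
   = \sum_i \sum_j (`|u i| * `|v j| - `|u j| * `|v i|) ^+ 2.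
  have E1 : (\sum_i `|u i| ^+ 2) * (\sum_i `|v i| ^+ 2)
      = \sum_i \sum_j `|u i| ^+ 2 * `|v j| ^+ 2 by rewrite big_distrlr.
  have E2 : (\sum_i `|u i| ^+ 2) * (\sum_i `|v i| ^+ 2)
      = \sum_i \sum_j `|u j| ^+ 2 * `|v i| ^+ 2 by rewrite E1 exchange_big.
  have E3 : (\sum_i `|u i| * `|v i|) ^+ 2
      = \sum_i \sum_j (`|u i| * `|v i|) * (`|u j| * `|v j|).
    by rewrite expr2 big_distrlr.
  have -> (x y : S) : 2 * (x - y) = x + x - (y + y) by ring.
  rewrite {1}E1 E2 E3 -!big_split -sumrB; apply: eq_bigr => i _.
  by rewrite -!big_split -sumrB; apply: eq_bigr => j _ /=; ring.
apply: sumr_ge0 => i _; apply: sumr_ge0 => j _.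
by rewrite real_exprn_even_ge0 // rpredB ?rpredM ?normr_real.
Qed.

Lemma ler_l2normD u v : l2norm (u + v) <= l2norm u + l2norm v.
Proof.
rewrite -ler_sqr_nneg ?addr_ge0 ?l2norm_ge0 // sqr_l2norm sqrrD !sqr_l2norm.
apply: (@le_trans _ _ (\sum_i (`|u i| + `|v i|) ^+ 2)).
  by apply: ler_sum => i _; rewrite ffunE ler_sqr_nneg ?addr_ge0 // ler_normD.
under eq_bigr do rewrite sqrrD.
rewrite !big_split /= lerD2r lerD2l -mulr2n lerMn2r //.
exact: cauchy_schwarz_sum.
Qed.

Lemma l2normZ (a : S) v : l2norm (a *: v) = `|a| * l2norm v.
Proof.
apply/eqP; rewrite -(eqrXn2 (n := 2)) ?mulr_ge0 ?l2norm_ge0 //.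
rewrite exprMn !sqr_l2norm mulr_sumr; apply/eqP; apply: eq_bigr => i _.
by rewrite ffunE normrM exprMn.
Qed.

Lemma l2norm_eq0 v : l2norm v = 0 -> v = 0.
Proof.
move=> v0; have := sqr_l2norm v; rewrite v0 expr0n /= => /esym/eqP.
rewrite psumr_eq0 => [/allP h|i _]; last by rewrite exprn_ge0.
apply/ffunP => i; rewrite ffunE; apply/eqP; rewrite -normr_eq0 -sqrf_eq0.
by apply: (h i); rewrite mem_index_enum.
Qed.
End Euclid.

HB.instance Definition _ (S : scalars) (I : finType) :=
  Lmodule_isNormed.Build S (euclid S I) (@ler_l2normD S I) (@l2normZ S I) (@l2norm_eq0 S I).

Section EuclidComplete.
Local Open Scope classical_set_scope.
Variables (S : scalars) (I : finType).
Local Notation V := (euclid S I).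

Lemma sqr_norm_euclid (v : V) : `|v| ^+ 2 = \sum_i `|v i| ^+ 2.
Proof. exact: sqr_l2norm. Qed.

Lemma norm_coord_le (v : V) i : `|v i| <= `|v|.
Proof.
rewrite -ler_sqr_nneg ?normr_ge0 // sqr_norm_euclid (bigD1 i) //= lerDl.
by rewrite sumr_ge0 // => j _; rewrite exprn_ge0.
Qed.

Lemma norm_le_sum (v : V) : `|v| <= \sum_i `|v i|.
Proof.
have s0 : 0 <= \sum_i `|v i| by rewrite sumr_ge0.
rewrite -ler_sqr_nneg ?normr_ge0 // sqr_norm_euclid expr2 mulr_suml.
apply: ler_sum => i _; rewrite expr2 ler_wpM2l //.
by rewrite (bigD1 i) //= lerDl sumr_ge0.
Qed.

(** Coordinates are 1-Lipschitz and the norm is at most the sum of the absolute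
values of the coordinates, so completeness is that of the scalars. *)
Lemma euclid_complete (F : set_system V) : ProperFilter F -> cauchy F -> cvg F.
Proof.
move=> FF Fc.
have coord i : cauchy ((fun v : V => v i : S) @ F).
  apply/cauchyP => e e0; move/cauchyP: Fc => /(_ e e0)[x Fx].
  exists (x i); suff : F [set v : V | ball (x i : S) e (v i : S)] by [].
  apply: filterS Fx => v; rewrite -!ball_normE /= => xv.
  apply: le_lt_trans xv; have -> : (x i : S) - v i = (x - v) i by rewrite !ffunE.
  exact: norm_coord_le.
have cv i : cvg ((fun v : V => v i : S) @ F) by apply: scalar_complete; exact: coord.
pose l : V := [ffun i => lim ((fun v : V => v i : S) @ F)].
apply/cvg_ex; exists l; apply/cvgrPdist_lt => e e0.
have m0 : 0 < (#|I|.+1)%:R :> S by rewrite ltr0n.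
have near_all : F [set v : V | forall i, `|(l i : S) - v i| < e / (#|I|.+1)%:R].
  apply: (@filter_forall _ _ (fun i => [set v : V | `|(l i : S) - v i| < _])) => i.
  have /cvgrPdist_lt/(_ (e / (#|I|.+1)%:R)) := cv i.
  by rewrite /l ffunE; apply; rewrite divr_gt0.
apply: filterS near_all => v hv.
apply: le_lt_trans (norm_le_sum _) _.
apply: (@le_lt_trans _ _ (\sum_(i : I) e / (#|I|.+1)%:R)).
  apply: ler_sum => i _; rewrite ffunE [X in _ + X]ffunE; exact: ltW (hv i).
rewrite sumr_const -[X in X < _]mulr_natr -mulrA gtr_pMr // mulrC ltr_pdivrMr // mul1r.
by rewrite ltr_nat.
Qed.
End EuclidComplete.

HB.instance Definition _ (S : scalars) (I : finType) :=
  Uniform_isComplete.Build (euclid S I) (@euclid_complete S I).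

Section EuclidHilbert.
Variables (S : scalars) (I : finType).
Local Notation V := (euclid S I).

Definition dotp (u v : V) : S := \sum_i u i * scalar_conj S (v i).

Fact dotp_additivel v : zmod_morphism (dotp ^~ v).
Proof.
by move=> x y; rewrite /dotp -sumrB; apply: eq_bigr => i _; rewrite !ffunE mulrBl.
Qed.
Fact dotp_additiver u : zmod_morphism (dotp u).
Proof.
by move=> x y; rewrite /dotp -sumrB; apply: eq_bigr => i _; rewrite !ffunE rmorphB mulrBr.
Qed.
Fact dotp_scalablel v : scalable_for *%R (dotp ^~ v).
Proof.
by move=> a x; rewrite /dotp mulr_sumr; apply: eq_bigr => i _; rewrite !ffunE mulrA.
Qed.
Fact dotp_scalabler u : scalable_for (@scalar_conj S \; *%R) (dotp u).
Proof.
move=> a x; rewrite /dotp /= mulr_sumr; apply: eq_bigr => i _.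
by rewrite !ffunE rmorphM mulrCA.
Qed.
HB.instance Definition _ := isBilinear.Build S V V S *%R (@scalar_conj S \; *%R) dotp
  dotp_additivel dotp_additiver dotp_scalablel dotp_scalabler.

Fact dotp_hermitian u v : dotp u v = (-1) ^+ false * scalar_conj S (dotp v u).
Proof.
rewrite expr0 mul1r /dotp rmorph_sum; apply: eq_bigr => i _.
by rewrite rmorphM scalar_conjK mulrC.
Qed.
HB.instance Definition _ := isHermitianSesquilinear.Build S V false (@scalar_conj S) dotp
  dotp_hermitian.

Lemma dotp_norm (v : V) : `|v| ^+ 2 = dotp v v.
Proof.
by rewrite sqr_norm_euclid; apply: eq_bigr => i _; rewrite mul_scalar_conj.
Qed.

Fact dotp_gt0 (u : V) : u != 0 -> 0 < dotp u u.
Proof. by move=> u0; rewrite -dotp_norm exprn_gt0 // normr_gt0. Qed.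
HB.instance Definition _ := isDotProduct.Build S V dotp dotp_gt0.

Definition euclidean_space : hilbertSpace (@scalar_conj S) :=
  @HilbertSpace S (@scalar_conj S) V dotp dotp_norm.
End EuclidHilbert.

(** * Real and complex scalars *)

Section Real.
Variable R : realType.
Lemma real_mul_conj (x : R) : x * (idfun : {rmorphism R -> R}) x = `|x| ^+ 2.
Proof. by rewrite /= real_normK ?num_real. Qed.

Definition real_scalars : scalars :=
  @Scalars R (idfun : {rmorphism R -> R}) (fun=> erefl) real_mul_conj Num.sqrt
    (fun x _ => sqrtr_ge0 x) (@sqr_sqrtr R)
    (fun F FF => @cauchy_cvg R F FF).
End Real.

Section Complex.
Local Open Scope classical_set_scope.
Variable R : realType.
Notation C := (complex R).

Lemma complex_norm_le (x : C) : `|x| <= (`|complex.Re x| + `|complex.Im x|)%:C%C.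
Proof.
rewrite normc_def lecR; case: x => a b /=.
rewrite -[leRHS]ger0_norm ?addr_ge0 // -sqrtr_sqr ler_wsqrtr //.
rewrite sqrrD !real_normK ?num_real // addrAC lerDl.
by rewrite mulrn_wge0 // mulr_ge0.
Qed.

Lemma normc_ge_Im (x : C) : `|complex.Im x|%:C%C <= `|x|.
Proof.
rewrite normc_def lecR; case: x => a b /=.
by rewrite -sqrtr_sqr ler_wsqrtr // lerDr sqr_ge0.
Qed.

Local Notation CF := ((complex R : numFieldType) : Type).

(** A Cauchy filter converges because its images under the real and imaginary
parts, which are 1-Lipschitz, do. *)
Lemma complex_complete (F : set_system CF) : ProperFilter F -> cauchy F -> cvg F.
Proof.
move=> FF /cauchyP Fc.
have part (f : CF -> R) : (forall x y, `|f x - f y|%:C%C <= `|x - y|) -> cvg (f @ F).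
  move=> f_lip; apply: cauchy_cvg; apply/cauchyP => e e0.
  have eC : 0 < e%:C%C by rewrite ltcR.
  have [x Fx] := Fc _ eC; exists (f x).
  suff : F [set y | ball (f x) e (f y)] by [].
  apply: filterS Fx => y; rewrite -!ball_normE /= => xy.
  by rewrite -ltcR; apply: le_lt_trans (f_lip x y) xy.
have cRe : cvg ((@complex.Re R : CF -> R) @ F).
  by apply: part => x y; rewrite -raddfB normc_ge_Re.
have cIm : cvg ((@complex.Im R : CF -> R) @ F).
  by apply: part => x y; rewrite -raddfB normc_ge_Im.
apply/cvg_ex; exists (Complex (lim ((@complex.Re R : CF -> R) @ F))
                              (lim ((@complex.Im R : CF -> R) @ F))).
apply/cvgrPdist_lt => e e0.
have [r r0 ->] : exists2 r : R, 0 < r & e = r%:C%C.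
  have /complex_realP[r er] : (e : C) \is Num.real := gtr0_real e0.
  by exists r; rewrite // -ltcR -er.
have r2 : 0 < r / 2 by rewrite divr_gt0.
move/cvgrPdist_lt : cRe => /(_ _ r2) nRe.
move/cvgrPdist_lt : cIm => /(_ _ r2) nIm.
near=> x.
apply: le_lt_trans (complex_norm_le _) _; rewrite ltcR !raddfB /=.
rewrite [ltRHS]splitr ltrD //; near: x; [exact: nRe | exact: nIm].
Unshelve. all: by end_near. Qed.

Lemma complex_mul_conj (x : C) : x * (@Num.conj C : {rmorphism C -> C}) x = `|x| ^+ 2.
Proof. by rewrite normCK. Qed.

Definition complex_scalars : scalars :=
  @Scalars C (@Num.conj C : {rmorphism C -> C}) (@conjCK C) complex_mul_conj (fun x : C => sqrtC x)
    (fun x x0 => etrans (sqrtC_ge0 x) x0) (fun x _ => sqrtCK x)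
    complex_complete.
End Complex.

(** * Optimality of the constant *)

(** The combination [c] of the dual vectors with coefficients the extremal vector
[y] satisfies [gram c = y] on the pure powers and [mu_bound * c = y] there, so
both sums are multiples of [\sum_i c (x_i^d) ^+ 2]. *)
Lemma gram_gap (R : realType) (n d : nat) (mu : R) :
  (0 < n)%N -> (0 < d)%N -> mu_bound R n d < mu ->
  exists c : seq 'I_n -> R,
    \sum_(u : d.-tuple 'I_n) \sum_(v : d.-tuple 'I_n) gram R d u v * (c u * c v)
      - mu * \sum_i c (power_word d i) ^+ 2 < 0.
Proof.
move=> n_gt0 d_gt0 mu_lt; have [y y_neq0 y_eigen] := extremal_vector R n_gt0 d_gt0.
pose c (v : seq 'I_n) := \sum_i gram_dual R d i v * y i; exists c.
have gram_c (u : d.-tuple 'I_n) : \sum_(v : d.-tuple 'I_n) gram R d u v * c v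
    = \sum_i (u == power_word d i)%:R * y i.
  under eq_bigr do rewrite mulr_sumr.
  rewrite exchange_big /=; apply: eq_bigr => i _; rewrite -sum_gram_dual // mulr_suml.
  by apply: eq_bigr => v _; rewrite mulrA.
have -> : \sum_(u : d.-tuple 'I_n) \sum_(v : d.-tuple 'I_n) gram R d u v * (c u * c v) =
    \sum_i c (power_word d i) * y i.
  transitivity (\sum_(u : d.-tuple 'I_n) \sum_i (u == power_word d i)%:R * (c u * y i)).
    apply: eq_bigr => u _; transitivity (c u * \sum_(v : d.-tuple 'I_n) gram R d u v * c v).
      by rewrite mulr_sumr; apply: eq_bigr => v _; rewrite mulrCA.
    by rewrite gram_c mulr_sumr; apply: eq_bigr => i _; rewrite mulrCA.
  rewrite exchange_big /=; apply: eq_bigr => i _.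
  rewrite (bigD1 (power_word d i)) //= eqxx mul1r big1 ?addr0 // => s /negPf ->.
  by rewrite mul0r.
have cy i : y i = mu_bound R n d * c (power_word d i) by rewrite y_eigen.
have -> : \sum_i c (power_word d i) * y i = mu_bound R n d * \sum_i c (power_word d i) ^+ 2.
  by rewrite mulr_sumr; apply: eq_bigr => i _; rewrite {1}cy; ring.
rewrite -mulrBl pmulr_llt0 ?subr_lt0 //.
rewrite lt0r sumr_ge0 ?andbT => [|i _]; last exact: sqr_ge0.
apply: contra y_neq0; rewrite !psumr_eq0 => [|i _|i _]; try exact: sqr_ge0.
move=> /allP h; apply/allP => i _; have := h i; rewrite mem_index_enum => /(_ isT) /=.
by rewrite !sqrf_eq0 cy => /eqP ->; rewrite mulr0.
Qed.

Section MatrixOperator.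
Variables (S : scalars) (I : finType) (m : I -> I -> S).
Local Notation V := (euclidean_space S I).

Definition matrix_op (v : V) : V := [ffun s => \sum_t m s t * v t] : euclid S I.

Fact matrix_op_linear : linear matrix_op.
Proof.
move=> a u v; apply/ffunP => s; rewrite !ffunE scaler_sumr -big_split /=.
by apply: eq_bigr => t _; rewrite !ffunE mulrDr mulrCA.
Qed.
HB.instance Definition _ := GRing.isLinear.Build S V V *:%R matrix_op matrix_op_linear.

Lemma matrix_op_bounded : bounded_op matrix_op.
Proof.
exists (\sum_s \sum_t `|m s t|) => v; apply: le_trans (norm_le_sum _) _.
rewrite mulr_suml; apply: ler_sum => s _; rewrite ffunE mulr_suml.
apply: le_trans (ler_norm_sum _ _ _) _; apply: ler_sum => t _.
by rewrite normrM ler_wpM2l // norm_coord_le.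
Qed.

Lemma matrix_op_self_adjoint :
  (forall s t, scalar_conj S (m s t) = m t s) -> self_adjoint matrix_op.
Proof.
move=> m_herm u v; rewrite /= /dotp.
under eq_bigr do rewrite ffunE mulr_suml.
under [RHS]eq_bigr do rewrite ffunE rmorph_sum mulr_sumr.
rewrite exchange_big /=; apply: eq_bigr => s _; apply: eq_bigr => t _.
by rewrite rmorphM m_herm mulrCA mulrA.
Qed.
End MatrixOperator.

Section Fock.
Variables (R : realType) (n d' : nat) (c : seq 'I_n -> R).
Local Notation d := d'.+1.

(** [Some x] is the basis vector of a word [x] of length less than [d], and [None]
a single vector on top of the words of length [d']. *)
Definition fock := option (d'.-bseq 'I_n).
HB.instance Definition _ := Finite.on fock.

(** Letters are put in front of words as in the full Fock space, except that the
last step sends [y] to [T * c (i :: y)] times the top vector. *)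
Definition creation (T : R) (i : 'I_n) (s s' : fock) : R :=
  match s, s' with
  | Some x, Some y => (bseqval x == i :: y)%:R
  | None, Some y => if size y == d' then T * c (i :: y) else 0
  | _, None => 0
  end.

Definition fock_op T i (s s' : fock) : R := creation T i s s' + creation T i s' s.

(** The coordinates of the image of the vacuum under the word [w]. *)
Fixpoint fock_vector T (w : seq 'I_n) (s : fock) : R :=
  if w is i :: w' then \sum_t fock_op T i s t * fock_vector T w' t
  else (s == Some [bseq])%:R.

Lemma big_fock (F : fock -> R) :
  \sum_s F s = F None + \sum_(x : d'.-bseq 'I_n) F (Some x).
Proof.
rewrite (bigD1 None) //=; congr (_ + _).
rewrite (reindex_omap Some id) /=; last by case.
by apply: eq_bigl => x; rewrite eqxx.
Qed.

(** With at most [d'] letters the top vector is out of reach, so [T] does not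
enter; and to reach a word as long as [w] every letter has to create, which
leaves [w] itself as the only one. *)
Lemma fock_vector_low T w : (size w <= d')%N ->
  [/\ fock_vector T w None = 0,
      forall x, fock_vector T w (Some x) = fock_vector 0 w (Some x) &
      forall x : d'.-bseq 'I_n, (size w <= size x)%N ->
        fock_vector T w (Some x) = (bseqval x == w)%:R].
Proof.
elim: w T => [|i w IH] T /=; first by split=> // x _; rewrite -val_eqE.
move=> wd; have [none some top] := IH T (ltnW wd); have [none0 _ _] := IH 0 (ltnW wd).
split=> [|y|y wy]; rewrite !big_fock ?none ?none0 ?mulr0 ?add0r.
- rewrite big1 // => x _; rewrite /fock_op /= addr0.
  case: eqP => [xd|_]; last by rewrite mul0r.
  rewrite top ?xd 1?ltnW //; case: eqP => [xw|_]; last by rewrite mulr0.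
  by move: wd; rewrite -xw xd ltnn.
- by apply: eq_bigr => x _; rewrite some.
- rewrite (bigD1 (Bseq (ltnW wd))) //= /fock_op /= top //= eqxx mulr1.
  rewrite big1 ?addr0 => [|x xw].
    case: (_ =P i :: y) => [wiy|_]; last by rewrite addr0.
    by move: wy; rewrite wiy /= => /ltnW; rewrite ltnn.
  have [yE|_] := eqVneq (bseqval y) (i :: x).
    have xs : (size w <= size x)%N by move: wy; rewrite yE.
    rewrite top //; have [xE|_] := eqVneq (bseqval x) w; last by rewrite mulr0.
    by move: xw; rewrite -val_eqE /= xE eqxx.
  have [xE|_] := eqVneq (bseqval x) (i :: y); last by rewrite addr0 mul0r.
  rewrite top; last by rewrite xE /= ltnW // ltnW.
  have [xw'|_] := eqVneq (bseqval x) w; last by rewrite mulr0.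
  by move: wy; rewrite -xw' xE /= => /ltnW; rewrite ltnn.
Qed.

Lemma fock_vector_top_none T w : size w = d -> fock_vector T w None = T * c w.
Proof.
case: w => // i w [wd] /=; have wd' : (size w <= d')%N by rewrite wd.
have [none _ top] := fock_vector_low T wd'.
rewrite big_fock none mulr0 add0r (bigD1 (Bseq wd')) //= /fock_op /= wd eqxx addr0.
rewrite top //= eqxx mulr1 big1 ?addr0 // => x xw.
case: eqP => [xd|_]; last by rewrite addr0 mul0r.
rewrite top ?xd //; case: eqP => [xE|_]; last by rewrite mulr0.
by move: xw; rewrite -val_eqE /= xE eqxx.
Qed.

(** The part below the top vector of an image under [d] letters comes from a
vector with no component at the top, hence does not see [T]. *)
Lemma fock_vector_top_some T w x : size w = d ->
  fock_vector T w (Some x) = fock_vector 0 w (Some x).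
Proof.
case: w => // i w [wd] /=; have wd' : (size w <= d')%N by rewrite wd.
have [none some _] := fock_vector_low T wd'; have [none0 _ _] := fock_vector_low 0 wd'.
by rewrite !big_fock none none0 !mulr0; congr (_ + _); apply: eq_bigr => y _; rewrite some.
Qed.

Lemma fock_opC T i s t : fock_op T i s t = fock_op T i t s.
Proof. by rewrite /fock_op addrC. Qed.
End Fock.

Section Optimality.
Variables (R : realType) (S : scalars) (iota : {rmorphism R -> S}).
Hypothesis conj_iota : forall x, scalar_conj S (iota x) = iota x.
Hypothesis iota_ge0 : forall x, 0 <= iota x -> 0 <= x.

Section Space.
Variables (n d' : nat) (c : seq 'I_n -> R).
Local Notation I := (fock n d').
Local Notation V := (euclidean_space S I).

Definition fock_operator T (i : 'I_n) : {linear V -> V} :=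
  matrix_op (fun s t => iota (fock_op (d' := d') c T i s t)).

Definition embed (f : I -> R) : V := [ffun s => iota (f s)] : euclid S I.

Lemma dotp_embed f g : dotp (embed f) (embed g) = iota (\sum_s f s * g s).
Proof.
by rewrite /dotp rmorph_sum; apply: eq_bigr => s _; rewrite !ffunE conj_iota rmorphM.
Qed.

Lemma fock_operator_embed T i f :
  fock_operator T i (embed f) = embed (fun s => \sum_t fock_op c T i s t * f t).
Proof.
apply/ffunP => s; rewrite !ffunE rmorph_sum; apply: eq_bigr => t _.
by rewrite ffunE rmorphM.
Qed.

Lemma word_eval_embed T (w : seq 'I_n) :
  word_eval (fock_operator T) (FMonom w) (embed (fock_vector (d' := d') c T [::]))
    = embed (fock_vector c T w).
Proof.
by rewrite /word_eval /=; elim: w => //= i w ->; rewrite fock_operator_embed.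
Qed.
End Space.

(** At the vacuum the form is [T ^+ 2 * Q + K0], where [Q] is the negative value
of [gram_gap] and [K0], collecting the components below the top vector, does
not depend on [T]. *)
Lemma power_sum_bound_le n d (mu : R) : (0 < n)%N -> (0 < d)%N ->
  power_sum_bound (@scalar_conj S) iota n d mu -> mu <= mu_bound R n d.
Proof.
move=> n_gt0 d_gt0 bound; rewrite leNgt; apply/negP => mu_gt.
have [c] := gram_gap n_gt0 d_gt0 mu_gt; set Q := _ - _ => Q_lt0.
case: d d_gt0 => // d' _ in bound mu_gt c Q Q_lt0 *.
pose r (w : seq 'I_n) (x : d'.-bseq 'I_n) : R := fock_vector c 0 w (Some x).
pose K0 := \sum_(u : d'.+1.-tuple 'I_n) \sum_(v : d'.+1.-tuple 'I_n)
    gram R d'.+1 u v * \sum_x r v x * r u x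
  - mu * \sum_i \sum_x r (power_word d'.+1 i) x * r (power_word d'.+1 i) x.
have main T : 0 <= T ^+ 2 * Q + K0.
  have dotE (u v : d'.+1.-tuple 'I_n) :
      \sum_(s : fock n d') fock_vector c T u s * fock_vector c T v s
      = T ^+ 2 * (c u * c v) + \sum_x r u x * r v x.
    have top (w : d'.+1.-tuple 'I_n) : fock_vector (d' := d') c T w None = T * c w.
      exact: fock_vector_top_none (size_tuple w).
    rewrite big_fock !top; congr (_ + _); first by ring.
    by apply: eq_bigr => x _; congr (_ * _); exact: fock_vector_top_some (size_tuple _).
  have ops i : bounded_op (fock_operator d' c T i) /\ self_adjoint (fock_operator d' c T i).
    split; first exact: matrix_op_bounded.
    by apply: matrix_op_self_adjoint => s t; rewrite conj_iota fock_opC.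
  have [_ /(_ (embed (fock_vector c T [::])))] := bound _ _ ops.
  have sa i := (ops i).2.
  rewrite innerBl innerZl inner_nc_eval_Hsym // inner_power_sum //.
  have E : \sum_(u : d'.+1.-tuple 'I_n) \sum_(v : d'.+1.-tuple 'I_n)
      gram R d'.+1 u v * (T ^+ 2 * (c v * c u) + \sum_x r v x * r u x)
      - mu * \sum_i (T ^+ 2 * (c (power_word d'.+1 i) * c (power_word d'.+1 i)) +
           \sum_x r (power_word d'.+1 i) x * r (power_word d'.+1 i) x) = T ^+ 2 * Q + K0.
    have -> : \sum_(u : d'.+1.-tuple 'I_n) \sum_(v : d'.+1.-tuple 'I_n)
        gram R d'.+1 u v * (T ^+ 2 * (c v * c u) + \sum_x r v x * r u x) =
        T ^+ 2 * (\sum_(u : d'.+1.-tuple 'I_n) \sum_(v : d'.+1.-tuple 'I_n)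
           gram R d'.+1 u v * (c u * c v)) +
        \sum_(u : d'.+1.-tuple 'I_n) \sum_(v : d'.+1.-tuple 'I_n)
           gram R d'.+1 u v * \sum_x r v x * r u x.
      rewrite mulr_sumr -big_split; apply: eq_bigr => u _.
      by rewrite mulr_sumr -big_split; apply: eq_bigr => v _ /=; ring.
    rewrite big_split /= -mulr_sumr /Q /K0.
    under [\sum_(i < n) c _ ^+ 2]eq_bigr do rewrite expr2.
    by ring.
  rewrite -E => h; apply: iota_ge0; move: h; congr (_ <= _).
  rewrite rmorphB rmorphM !rmorph_sum; congr (_ - _ * _).
    apply: eq_bigr => u _; rewrite rmorph_sum; apply: eq_bigr => v _.
    rewrite [RHS]rmorphM !word_eval_embed -dotE; congr (_ * _); exact: dotp_embed.
  by apply: eq_bigr => i _; rewrite !word_eval_embed -dotE; exact: dotp_embed.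
have nQ : 0 < - Q by rewrite oppr_gt0.
pose t := (`|K0| + 1) / - Q; have t0 : 0 < t by rewrite divr_gt0 // ltr_wpDl.
(* [(1 + t) ^+ 2 * Q <= t * Q = - (`|K0| + 1)] *)
have := main (1 + t); apply/negP; rewrite -ltNge.
have tQ : t * Q = - (`|K0| + 1) by rewrite /t invrN mulrN mulNr divfK // lt_eqF.
apply: (@le_lt_trans _ _ (t * Q + K0)); last by rewrite tQ; have := ler_norm K0; lra.
rewrite lerD2r ler_wnM2r ?ltW // expr2; nra.
Qed.
End Optimality.

(** * The theorem *)

Theorem theorem1p1 (R : realType) (n d : nat)
    (n_gt0 : (0 < n)%N) (d_gt0 : (0 < d)%N) :
  ((exists q : 'I_('C(n - 1 + d, d)) -> ncpoly R n,
      Hsym R n (2 * d) = \sum_j ncstar (q j) * q j) /\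
   (forall (r : nat) (q : 'I_r -> ncpoly R n),
      Hsym R n (2 * d) = \sum_j ncstar (q j) * q j ->
      ('C(n - 1 + d, d) <= r)%N)) /\
  ((complex_bound n d (mu_bound R n d) /\
    (forall mu : R, complex_bound n d mu -> mu <= mu_bound R n d)) /\
   (real_bound n d (mu_bound R n d) /\
    (forall mu : R, real_bound n d mu -> mu <= mu_bound R n d))).
Proof.
have conj_real_complex (x : R) : (real_complex R x : complex R)^* = real_complex R x.
  by rewrite conj_Creal // complex_real.
have le_real_complex (x : R) : (0 <= real_complex R x) = (0 <= x) by rewrite lecR.
split; first by split; [exact: Hsym_sum_of_squares | exact: Hsym_squares_minimal].
split; split.
- by apply: (mu_bound_power_sum_bound (iota := real_complex R)) => // x; rewrite le_real_complex.
- move=> mu; apply: (@power_sum_bound_le R (complex_scalars R) (real_complex R)) => // x.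
  by rewrite le_real_complex.
- exact: (mu_bound_power_sum_bound (iota := idfun : {rmorphism R -> R})).
- by move=> mu; exact: (@power_sum_bound_le R (real_scalars R) (idfun : {rmorphism R -> R})).
Qed.
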